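(* Let $f=\frac1n\sum_{i=1}^nf_i:\mathbb{R}^d\to\mathbb{R}$ be convex, $\mu$-quasi strongly convex with $\mu\ge0$ (with unique minimizer $x^*$) and $L$-smooth, let each $f_i$ have the finite-sum form $f_i=\frac1m\sum_{j=1}^mf_{ij}$, and let the Expected Smoothness assumption hold with constant $\mathcal{L}>0$ for the sampling distributions $\mathcal{D}_1,\dots,\mathcal{D}_n$. Let $R_0=\|x^0-x^*\|$, $\gamma_0=\left(4L+\frac{152\mathcal{L}}{3n}\right)^{-1}$ and $\widetilde T_0=\|x^0-x^*\|^2+\frac{64m}{3n}\gamma_0^2\mathcal{L}(f(x^0)-f(x^* ))$. Then for every $K\ge1$ there exists a choice of stepsize $0<\gamma\le\gamma_0$ (possibly depending on $K$) such that EC-LSVRG with $p=\frac1m$ and an absolute compression operator with constant $\Delta\ge0$ guarantees that $\mathbb{E}[f(\overline{x}^K)-f(x^* )]$ is of the order $$\widetilde{\mathcal{O}}\left(\left(L+\frac{\mathcal{L}}{n}\right)\widetilde T_0\exp\left(-\min\left\{\frac{\mu}{L+\mathcal{L}/n},\frac1m\right\}K\right)+\frac{L\Delta^2}{\mu^2K^2}\right)\quad\text{when }\mu>0,$$ $$\mathcal{O}\left(\frac{(L+\mathcal{L}/n)R_0^2}{K}+\frac{\sqrt{m\mathcal{L}L}\,R_0^2}{\sqrt{n}\,K}+\frac{L^{1/3}R_0^{4/3}\Delta^{2/3}}{K^{2/3}}\right)\quad\text{when }\mu=0.$$ Here $\overline{x}^K=\frac1{W_K}\sum_{k=0}^Kw_kx^k$,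 $w_k=(1-\eta)^{-(k+1)}$, $W_K=\sum_{k=0}^Kw_k$, $\eta=\min\{\frac{\gamma\mu}{2},\frac{p}{4}\}$ (the real weights $w_k$ are not to be confused with the reference points of EC-LSVRG).
   Context: Problem: minimize $f(x)=\frac1n\sum_{i=1}^n f_i(x)$ over $x\in\mathbb{R}^d$, with $f_i(x)=\frac1m\sum_{j=1}^mf_{ij}(x)$ and differentiable $f_{ij}:\mathbb{R}^d\to\mathbb{R}$; the minimizer $x^*$ of $f$ is unique. $f$ is $\mu$-quasi strongly convex ($\mu\ge0$) if $f(x^* )\ge f(x)+\langle\nabla f(x),x^*-x\rangle+\frac{\mu}{2}\|x-x^*\|^2$ for all $x$. $f$ is $L$-smooth if $\|\nabla f(x)-\nabla f(y)\|\le L\|x-y\|$ for all $x,y$. Stochastic reformulation: for each $i$, $\xi_i=(\xi_{i1},\dots,\xi_{im})^\top$ is a random vector with distribution $\mathcal{D}_i$ such that $\mathbb{E}[\xi_{ij}]=1$ for all $j$, and $f_{\xi_i}(x)=\frac1m\sum_{j=1}^m\xi_{ij}f_{ij}(x)$. Expected Smoothness assumption (constant $\mathcal{L}>0$): for all $x\in\mathbb{R}^d$ and all $i=1,\dots,n$, $$\mathbb{E}_{\xi_i\sim\mathcal{D}_i}\left[\|\nabla f_{\xi_i}(x)-\nabla f_{\xi_i}(x^* )\|^2\right]\le2\mathcal{L}\left(f_i(x)-f_i(x^* )-\langle\nabla f_i(x^* ),x-x^*\rangle\right).$$ Absolute compression operator: a (possibly stochastic) map $\mathcal{C}:\mathbb{R}^d\to\mathbb{R}^d$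 for which there is $\Delta\ge0$ with $\mathbb{E}[\|\mathcal{C}(x)-x\|^2]\le\Delta^2$ for all $x\in\mathbb{R}^d$. If $\mathcal{C}$ is stochastic, each application uses fresh randomness. EC-SGD: given $x^0\in\mathbb{R}^d$ and stepsize $\gamma>0$, set $e_i^0=0$ for $i=1,\dots,n$. For $k=0,1,2,\dots$, each worker $i$ computes a stochastic gradient $g_i^k$, sets $v_i^k=\gamma\,\mathcal{C}\!\left(\frac{e_i^k+\gamma g_i^k}{\gamma}\right)$ and $e_i^{k+1}=e_i^k+\gamma g_i^k-v_i^k$; then $x^{k+1}=x^k-v^k$ with $v^k=\frac1n\sum_{i=1}^n v_i^k$. EC-LSVRG is EC-SGD with $$g_i^k=\nabla f_{\xi_i^k}(x^k)-\nabla f_{\xi_i^k}(w^k)+\nabla f_i(w^k),$$ where $\xi_i^k$ is sampled from $\mathcal{D}_i$ independently of previous steps and of the other workers, and the reference point $w^k\in\mathbb{R}^d$ (common to all workers) satisfies $w^0=x^0$ and $w^{k+1}=x^k$ with probability $p$, $w^{k+1}=w^k$ with probability $1-p$ (independent coin at each step). Order notation: $\mathcal{O}(\cdot)$ hides an absolute numerical constant. $\widetilde{\mathcal{O}}(\cdot)$ hides absolute numerical constants (including a positive absolute constant factor in the exponent) and factors polynomial in logarithms of $K$ and of the problem parameters.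
   Formalization: For μ=0 the formal theorem excludes the case x^0=x^* with Δ>0: there R_0=0 makes the stated bound zero, yet a random-sign compressor C(x)=x±Δ moves the iterates off x^*, so the claim fails; the case μ>0 is unrestricted. *)

(* Defs.v *)
From HB Require Import structures.
From mathcomp Require Import all_boot all_order all_algebra finmap.
From mathcomp Require Import all_classical all_reals all_analysis.

Set Implicit Arguments.
Unset Strict Implicit.
Unset Printing Implicit Defensive.

Import Order.TTheory GRing.Theory Num.Theory.
Import numFieldNormedType.Exports.

Local Open Scope classical_set_scope.
Local Open Scope ring_scope.

(* The library norm on 'rV[R]_d is the sup norm; everything below uses the
   Euclidean norm instead. The topology, hence differentiability and the Borel
   sigma-algebra, is the same for both. *)
Definition dotv (R : realType) (d : nat) (u v : 'rV[R]_d) : R :=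
  \sum_(j < d) u 0 j * v 0 j.

Definition enorm (R : realType) (d : nat) (u : 'rV[R]_d) : R :=
  Num.sqrt (dotv u u).

(* Gradient with respect to [dotv]; [h] is meant to be differentiable. *)
Definition grad (R : realType) (d : nat) (h : 'rV[R]_d -> R) (x : 'rV[R]_d) :
  'rV[R]_d := \row_(j < d) 'D_(delta_mx 0 j) h x.

Notation borel_rV R d := (g_sigma_algebraType (@open 'rV[R]_d)).

Section finite_sum.
Variables (R : realType) (d n m : nat).
Variable fij : 'I_n -> 'I_m -> 'rV[R]_d -> R.

Definition fworker (i : 'I_n) (x : 'rV[R]_d) : R :=
  m%:R^-1 * \sum_(j < m) fij i j x.

Definition fobj (x : 'rV[R]_d) : R := n%:R^-1 * \sum_(i < n) fworker i x.

Definition fsample (i : 'I_n) (xi : 'rV[R]_m) (x : 'rV[R]_d) : R :=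
  m%:R^-1 * \sum_(j < m) xi 0 j * fij i j x.

End finite_sum.

Section assumptions.
Variables (R : realType) (d : nat).
Implicit Types (f : 'rV[R]_d -> R) (xstar : 'rV[R]_d).

Definition unique_minimizer f xstar : Prop :=
  (forall x, f xstar <= f x) /\
  (forall y, (forall x, f y <= f x) -> y = xstar).

Definition quasi_strongly_convex f xstar (mu : R) : Prop :=
  forall x, f x + dotv (grad f x) (xstar - x) + mu / 2 * enorm (x - xstar) ^+ 2
            <= f xstar.

Definition smooth f (L : R) : Prop :=
  forall x y, enorm (grad f x - grad f y) <= L * enorm (x - y).

(* Since the expectation is the extended-real Lebesgue integral, the value 1
   entails that [xi_ij] is integrable. *)
Definition unit_mean_sampling (n m : nat)
    (D : 'I_n -> probability (borel_rV R m) R) : Prop :=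
  forall i j, ('E_(D i)[fun xi : 'rV[R]_m => (xi 0 j)%R] = 1)%E.

Definition expected_smoothness (n m : nat)
    (fij : 'I_n -> 'I_m -> 'rV[R]_d -> R)
    (D : 'I_n -> probability (borel_rV R m) R) xstar (Ls : R) : Prop :=
  forall (x : 'rV[R]_d) (i : 'I_n),
    ('E_(D i)[fun xi => (enorm (grad (fsample fij i xi) x
                                - grad (fsample fij i xi) xstar) ^+ 2)%R]
     <= (2 * Ls * (fworker fij i x - fworker fij i xstar
                   - dotv (grad (fworker fij i) xstar) (x - xstar)))%:E)%E.

(* A possibly stochastic operator is a map [C z] depending on a seed [z] drawn
   from [Q]; deterministic operators are the case where [C z] ignores [z]. *)
Definition absolute_compressor (dZ : measure_display) (Z : measurableType dZ)
    (Q : probability Z R) (C : Z -> 'rV[R]_d -> 'rV[R]_d) (Delta : R) : Prop :=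
  measurable_fun [set: Z * borel_rV R d]
    ((fun zx => C zx.1 zx.2) : Z * borel_rV R d -> borel_rV R d) /\
  forall x, ('E_Q[fun z => (enorm (C z x - x) ^+ 2)%R] <= (Delta ^+ 2)%:E)%E.

End assumptions.

Section algorithm.
Variables (R : realType) (d n m : nat).

Record ec_state : Type := EcState {
  ec_x : 'rV[R]_d ;
  ec_w : 'rV[R]_d ;
  ec_e : 'I_n -> 'rV[R]_d }.

Definition lsvrg_grad (fij : 'I_n -> 'I_m -> 'rV[R]_d -> R)
    (xi : 'I_n -> 'rV[R]_m) (x w : 'rV[R]_d) (i : 'I_n) : 'rV[R]_d :=
  grad (fsample fij i (xi i)) x - grad (fsample fij i (xi i)) w
  + grad (fworker fij i) w.

(* One step, for realized samples [xi], realized compressors [Cmp] (one per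
   worker) and a realized coin. *)
Definition ec_lsvrg_step (fij : 'I_n -> 'I_m -> 'rV[R]_d -> R) (gamma : R)
    (xi : 'I_n -> 'rV[R]_m) (Cmp : 'I_n -> 'rV[R]_d -> 'rV[R]_d) (coin : bool)
    (s : ec_state) : ec_state :=
  let g := lsvrg_grad fij xi (ec_x s) (ec_w s) in
  let v i := gamma *: Cmp i (gamma^-1 *: (ec_e s i + gamma *: g i)) in
  {| ec_x := ec_x s - n%:R^-1 *: \sum_(i < n) v i ;
     ec_w := if coin then ec_x s else ec_w s ;
     ec_e := fun i => ec_e s i + gamma *: g i - v i |}.

Fixpoint ec_lsvrg (fij : 'I_n -> 'I_m -> 'rV[R]_d -> R) (gamma : R)
    (xi : nat -> 'I_n -> 'rV[R]_m) (Cmp : nat -> 'I_n -> 'rV[R]_d -> 'rV[R]_d)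
    (coin : nat -> bool) (x0 : 'rV[R]_d) (k : nat) : ec_state :=
  if k is k'.+1 then
    ec_lsvrg_step fij gamma (xi k') (Cmp k') (coin k')
      (ec_lsvrg fij gamma xi Cmp coin x0 k')
  else {| ec_x := x0 ; ec_w := x0 ; ec_e := fun=> 0 |}.

Definition ec_eta (gamma mu p : R) : R := Num.min (gamma * mu / 2) (p / 4).

Definition weighted_average (eta : R) (x : nat -> 'rV[R]_d) (K : nat) :
    'rV[R]_d :=
  let wt k := ((1 - eta) ^+ k.+1)^-1 in
  (\sum_(k < K.+1) wt k)^-1 *: \sum_(k < K.+1) wt k *: x k.

End algorithm.

Section randomness.
Variables (R : realType) (dO : measure_display) (Omega : measurableType dO).
Variable P : probability Omega R.

Definition mutually_independent (I : choiceType)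
    (F : I -> set (set Omega)) : Prop :=
  forall (J : {fset I}) (E : I -> set Omega),
    (forall a, a \in J -> F a (E a)) ->
    P (\bigcap_(a in [set` J]) E a) = (\prod_(a <- J) P (E a))%E.

Definition sigma_of (dT : measure_display) (T : measurableType dT)
    (X : Omega -> T) : set (set Omega) :=
  preimage_set_system [set: Omega] X measurable.

(* All the randomness of a run: sample [xi k i] and compression seed
   [zeta k i] of worker [i] at step [k], and the coin of step [k]. *)
Definition ec_lsvrg_noise (n m : nat)
    (D : 'I_n -> probability (borel_rV R m) R)
    (dZ : measure_display) (Z : measurableType dZ) (Q : probability Z R) (p : R)
    (xi : nat -> 'I_n -> {RV P >-> borel_rV R m})
    (zeta : nat -> 'I_n -> {RV P >-> Z})
    (coin : nat -> {RV P >-> bool}) : Prop :=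
  [/\ forall k i A, measurable A -> distribution P (xi k i) A = D i A,
      forall k i A, measurable A -> distribution P (zeta k i) A = Q A,
      forall k, P (coin k @^-1` [set true]) = p%:E
    & mutually_independent
        (fun a : nat * 'I_n + nat * 'I_n + nat =>
           match a with
           | inl (inl (k, i)) => sigma_of (xi k i)
           | inl (inr (k, i)) => sigma_of (zeta k i)
           | inr k => sigma_of (coin k)
           end)].

End randomness.

Section rates.
Variable R : realType.

Definition gamma0 (n : nat) (L Ls : R) : R :=
  (4 * L + (152 * Ls) / (3 * n%:R))^-1.

(* [gap0] stands for f x0 - f xstar. *)
Definition Ttilde0 (n m : nat) (L Ls R0 gap0 : R) : R :=
  R0 ^+ 2 + (64 * m%:R) / (3 * n%:R) * gamma0 n L Ls ^+ 2 * Ls * gap0.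

(* Each power of [logs] is a polynomial in |ln K|, |ln L|, ..., and every
   polynomial in these quantities is at most a constant times such a power.
   The library has ln 0 = 0, so a parameter that is zero contributes nothing. *)
Definition logs (K n m : nat) (mu L Ls Delta T : R) : R :=
  1 + `|ln (K%:R : R)| + `|ln (n%:R : R)| + `|ln (m%:R : R)|
    + `|ln mu| + `|ln L| + `|ln Ls| + `|ln Delta| + `|ln T|.

Definition rate_strongly_convex (a : R) (K n m : nat) (mu L Ls Delta T : R) : R :=
  (L + Ls / n%:R) * T
    * expR (- (a * Num.min (mu / (L + Ls / n%:R)) m%:R^-1 * K%:R))
  + L * Delta ^+ 2 / (mu ^+ 2 * K%:R ^+ 2).

Definition rate_convex (K n m : nat) (L Ls Delta R0 : R) : R :=
  (L + Ls / n%:R) * R0 ^+ 2 / K%:R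
  + Num.sqrt (m%:R * Ls * L) * R0 ^+ 2 / (Num.sqrt n%:R * K%:R)
  + L `^ (1 / 3) * R0 `^ (4 / 3) * Delta `^ (2 / 3) / K%:R `^ (2 / 3).

End rates.

(* Main.v *)
Require Import Defs.
From HB Require Import structures.
From mathcomp Require Import all_boot all_order all_algebra finmap.
From mathcomp Require Import all_classical all_reals all_analysis.
From mathcomp Require Import measurable_realfun ring lra.

Set Implicit Arguments.
Unset Strict Implicit.
Unset Printing Implicit Defensive.

Import Order.TTheory GRing.Theory Num.Theory.
Import numFieldNormedType.Exports.

Local Open Scope classical_set_scope.
Local Open Scope ring_scope.

(* The virtual iterate x - e, where e is the mean of the worker errors, performs
   exact SGD steps because the compressors cancel in it, and E|e|^2 <= (gamma Delta)^2
   because the compressor is absolute. Expanding |x - e - xstar|^2, with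
   quasi-strong convexity, |grad f|^2 <= 2 L (f - f xstar), expected smoothness and the
   independence of the workers (variance of a sum), shows that the Lyapunov function
     T_k = E|x_k - e_k - xstar|^2 + 16 m Ls / (3 n) gamma^2 E(f(w_k) - f xstar)
   satisfies
     T_(k+1) + gamma / 2 E(f(x_k) - f xstar) <= (1 - eta) T_k + 4 L gamma^3 Delta^2.
   Summing with the weights (1 - eta)^-(k+1), of total mass W, and Jensen's inequality
   give E(f(xbar) - f xstar) <= 2 T_0 / (gamma W) + 8 L gamma^2 Delta^2. It remains to
   bound W below by (K + 1) exp(eta K / 2) and to choose gamma. *)

(** * Euclidean geometry and smooth functions *)

(** Each step calls for an expectation given the past. In place of conditional expectations, the
    sample space carries one sigma-algebra for each set of noise indices, and a bound that holds for
    every frozen past is integrated by Tonelli's theorem. The virtual iterate helps here too: its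
    update contains the samples of the step but no compression seed, so only the samples have to be
    averaged.

    Finiteness of the moments is part of what must be proved. The recursions are therefore stated
    for extended-real integrals of nonnegative functions; an induction on the step then yields
    finiteness, and only afterwards does the recursion become one between real numbers.

    The stepsize is fixed before the compressor and the probability space, so it is chosen by pure
    real analysis from the parameters. A single lower bound on W has to serve both regimes: for mu =
    0 the weights are constant and the factor K + 1 is everything, for mu > 0 the exponential growth
    is needed as well. *)

Section euclidean.
Variables (R : realType) (d : nat).
Implicit Types (u v w : 'rV[R]_d) (a : R).

Lemma dotvC u v : dotv u v = dotv v u.
Proof. by apply: eq_bigr => j _; rewrite mulrC. Qed.

Lemma dotvDl u v w : dotv (u + v) w = dotv u w + dotv v w.
Proof. by rewrite -big_split; apply: eq_bigr => j _; rewrite !mxE mulrDl. Qed.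

Lemma dotvZl a u v : dotv (a *: u) v = a * dotv u v.
Proof. by rewrite mulr_sumr; apply: eq_bigr => j _; rewrite !mxE mulrA. Qed.

Lemma dotvNl u v : dotv (- u) v = - dotv u v.
Proof. by rewrite -scaleN1r dotvZl mulN1r. Qed.

Lemma dotvDr u v w : dotv u (v + w) = dotv u v + dotv u w.
Proof. by rewrite !(dotvC u) dotvDl. Qed.

Lemma dotvZr a u v : dotv u (a *: v) = a * dotv u v.
Proof. by rewrite !(dotvC u) dotvZl. Qed.

Lemma dotvNr u v : dotv u (- v) = - dotv u v.
Proof. by rewrite !(dotvC u) dotvNl. Qed.

Definition dotvE := (dotvDl, dotvDr, dotvNl, dotvNr, dotvZl, dotvZr).

Lemma dotv0l u : dotv 0 u = 0.
Proof. by apply: big1 => j _; rewrite mxE mul0r. Qed.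

Lemma dotv_suml I (r : seq I) (F : I -> 'rV[R]_d) v :
  dotv (\sum_(i <- r) F i) v = \sum_(i <- r) dotv (F i) v.
Proof.
elim: r => [|i r IHr]; first by rewrite !big_nil dotv0l.
by rewrite !big_cons dotvDl IHr.
Qed.

Lemma dotv_ge0 u : 0 <= dotv u u.
Proof. by apply: sumr_ge0 => j _; rewrite -expr2 sqr_ge0. Qed.

Lemma dotv_eq0 u : dotv u u = 0 -> u = 0.
Proof.
move=> /eqP; rewrite psumr_eq0 => [/allP u0|j _]; last by rewrite -expr2 sqr_ge0.
apply/rowP => j; rewrite mxE; apply/eqP; rewrite -sqrf_eq0 expr2.
by apply: u0; rewrite mem_index_enum.
Qed.

Lemma sqr_enorm u : enorm u ^+ 2 = dotv u u.
Proof. by rewrite sqr_sqrtr // dotv_ge0. Qed.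

Lemma enorm_ge0 u : 0 <= enorm u. Proof. exact: sqrtr_ge0. Qed.

Lemma dotv_young u v a : 0 < a -> 2 * dotv u v <= a * dotv u u + a^-1 * dotv v v.
Proof.
move=> a0; have := dotv_ge0 (a *: u - v).
rewrite !dotvE (dotvC v u) => h.
rewrite -(ler_pM2l a0) mulrDr (mulrA a a^-1) divff ?gt_eqF// mul1r; lra.
Qed.

(** Young's inequality with the weight |v| / |u|, which turns both of its terms into |u| |v|. The
    weight must be positive, so zero vectors are treated apart. *)
Lemma dotv_le_enorm u v : dotv u v <= enorm u * enorm v.
Proof.
have enorm0 w : enorm w = 0 -> w = 0.
  by move=> w0; apply: dotv_eq0; rewrite -sqr_enorm w0 expr0n.
have [/enorm0 ->|u0] := eqVneq (enorm u) 0.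
  by rewrite dotv0l mulr_ge0 ?enorm_ge0.
have [/enorm0 ->|v0] := eqVneq (enorm v) 0.
  by rewrite dotvC dotv0l mulr_ge0 ?enorm_ge0.
have up : 0 < enorm u by rewrite lt_def enorm_ge0 u0.
have vp : 0 < enorm v by rewrite lt_def enorm_ge0 v0.
have := dotv_young u v (divr_gt0 vp up); rewrite -!sqr_enorm invf_div => h.
suff : 2 * dotv u v <= 2 * (enorm u * enorm v) by rewrite ler_pM2l.
apply: (le_trans h); rewrite le_eqVlt; apply/orP; left; apply/eqP; field.
by rewrite u0 v0.
Qed.

Lemma dotv_sub_le u v :
  dotv (u - v) (u - v) <= 2 * dotv u u + 2 * dotv v v.
Proof. have := dotv_ge0 (u + v); rewrite !dotvE (dotvC v u); lra. Qed.

(** With c the mean of the F i, the sum of |F i - c|^2 equals the sum of |F i|^2 minus n |c|^2, and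
    it is nonnegative. *)
Lemma dotv_mean_le n (F : 'I_n -> 'rV[R]_d) : (0 < n)%N ->
  dotv (n%:R^-1 *: \sum_i F i) (n%:R^-1 *: \sum_i F i)
    <= n%:R^-1 * \sum_i dotv (F i) (F i).
Proof.
move=> n0; have nn : n%:R != 0 :> R by rewrite pnatr_eq0 -lt0n.
(* [c] is known only through its equation, so that the sum can be rewritten as n c without unfolding
   [c] again. *)
have [c cE] : {c | c = n%:R^-1 *: \sum_i F i} by exists (n%:R^-1 *: \sum_i F i).
have sE : \sum_i F i = n%:R *: c by rewrite cE scalerA divff // scale1r.
rewrite -cE.
have e1 i : dotv (F i - c) (F i - c)
    = dotv (F i) (F i) + (- 2) * dotv (F i) c + dotv c c.
  rewrite !dotvE (dotvC c (F i)); ring.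
have e : \sum_i dotv (F i - c) (F i - c)
    = \sum_i dotv (F i) (F i) - n%:R * dotv c c.
  under eq_bigr do rewrite e1.
  rewrite !big_split /= -mulr_sumr -dotv_suml sE dotvZl.
  rewrite sumr_const card_ord -mulr_natl; ring.
have : 0 <= \sum_i dotv (F i - c) (F i - c).
  by apply: sumr_ge0 => i _; exact: dotv_ge0.
rewrite e subr_ge0 => h.
by rewrite -ler_pdivrMl ?invr_gt0 ?ltr0n // invrK.
Qed.

End euclidean.

Section gradient.
Variables (R : realType) (d : nat).
Implicit Types (f : 'rV[R]_d -> R) (x y h : 'rV[R]_d).

Lemma diff_dotv f x h : differentiable f x -> 'd f x h = dotv (grad f x) h.
Proof.
move=> df; rewrite {1}(row_sum_delta h) linear_sum; apply: eq_bigr => j _.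
by rewrite linearZ /= mxE deriveE // mulrC.
Qed.

(** The weights [a] are the sample entries for [fsample] and 1 for [fworker] and [fobj], so one
    computation gives all three gradients. *)
Lemma grad_scale_sum (J : nat) (a : 'I_J -> R) (b : R) (F : 'I_J -> 'rV[R]_d -> R) x :
  (forall j, differentiable (F j) x) ->
  grad (fun y => b * \sum_j a j * F j y) x = b *: \sum_j a j *: grad (F j) x.
Proof.
move=> dF; apply/rowP => k; rewrite !mxE summxE.
rewrite (_ : (fun _ => _) = b *: \sum_j (a j *: F j)); last first.
  by apply/funext => y; rewrite /= fct_sumE /=; congr (_ * _); apply: eq_bigr.
have ders j : derivable (a j *: F j) x (delta_mx 0 k).
  by apply: derivableZ; exact: diff_derivable.
rewrite deriveZ; last exact: derivable_sum.
rewrite derive_sum //; congr (_ * _); apply: eq_bigr => j _.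
by rewrite !mxE deriveZ //; exact: diff_derivable.
Qed.

Lemma differentiable_scale_sum (J : nat) (b : R) (F : 'I_J -> 'rV[R]_d -> R) x :
  (forall j, differentiable (F j) x) ->
  differentiable (fun y => b * \sum_j F j y) x.
Proof.
move=> dF.
rewrite (_ : (fun _ => _) = b *: \sum_j F j); last first.
  by apply/funext => y; rewrite /= fct_sumE.
by apply: differentiableZ; exact: differentiable_sum.
Qed.

Lemma is_derive_line f x h (t : R) : differentiable f (x + t *: h) ->
  is_derive t 1 (fun s : R => f (x + s *: h)) (dotv (grad f (x + t *: h)) h).
Proof.
move=> df.
have lin : is_diff t (fun s : R => x + s *: h) (fun s => s *: h).
  rewrite (_ : (fun s => s *: h) = (0 : R -> _) + ( *:%R^~ h)); last first.
    by apply/funext => s; rewrite /= add0r.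
  apply: is_diffD.
have dg : differentiable (fun s : R => f (x + s *: h)) t.
  exact: (@differentiable_comp _ _ _ _ (fun s : R => x + s *: h) f).
apply: DeriveDef; first exact: diff_derivable.
rewrite deriveE //.
rewrite (@diff_comp _ _ _ _ (fun s : R => x + s *: h) f) //=.
by rewrite diff_val scale1r diff_dotv.
Qed.

(** [phi] is f along the segment minus its quadratic model. By the Lipschitz bound and
    Cauchy-Schwarz its derivative is nonpositive on [0, 1], so phi 1 <= phi 0; no integral of the
    gradient is involved. *)
Lemma smooth_descent f (L : R) x h :
  (forall y, differentiable f y) -> smooth f L ->
  f (x + h) <= f x + dotv (grad f x) h + L / 2 * dotv h h.
Proof.
move=> df sf.
pose phi (t : R) := f (x + t *: h) - t * dotv (grad f x) h - t ^+ 2 * (L / 2 * dotv h h).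
pose dphi (t : R) := dotv (grad f (x + t *: h)) h - dotv (grad f x) h
    - (2 * t) * (L / 2 * dotv h h).
have dp (t : R) : is_derive t 1 phi (dphi t).
  rewrite /phi.
  have H1 := is_derive_line (df (x + t *: h)).
  apply: is_derive_eq.
  rewrite /dphi /GRing.scale /=; ring.
have : phi 1 <= phi 0.
  apply: (@ler0_derive1_le_cc R phi 0 1) => //.
  - move=> t; rewrite in_itv /= => /andP[t0 t1].
    rewrite derive1E derive_val /dphi.
    have := dotv_le_enorm (grad f (x + t *: h) - grad f x) h.
    have := sf (x + t *: h) x.
    rewrite [x + _]addrC addrK dotvDl dotvNl -sqr_enorm.
    have -> : enorm (t *: h) = t * enorm h.
      rewrite /enorm !dotvE mulrA -expr2 sqrtrM ?sqr_ge0 // sqrtr_sqr.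
      by rewrite gtr0_norm.
    have := enorm_ge0 h; have := enorm_ge0 (grad f (t *: h + x) - grad f x).
    move: (enorm (grad f _ - _)) (enorm h) => p q p0 q0 h1 h2.
    have : p * q <= L * (t * q) * q by rewrite ler_wpM2r.
    rewrite expr2; lra.
  - apply: derivable_within_continuous => t _; exact: ex_derive.
  - by rewrite in_itv /= lexx ler01.
  - by rewrite in_itv /= lexx ler01.
rewrite /phi scale1r scale0r addr0 !mul1r mul0r expr1n expr0n /= mul0r mul1r; lra.
Qed.

(** A gradient step of length t stays above fmin, and the descent inequality turns this into [key];
    t = 1 / L is the optimal choice. *)
Lemma smooth_grad_sqr_le f (L : R) (fmin : R) x : 0 <= L ->
  (forall y, differentiable f y) -> smooth f L -> (forall y, fmin <= f y) ->
  dotv (grad f x) (grad f x) <= 2 * L * (f x - fmin).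
Proof.
move=> L0 df sf fmin_le; set G := dotv _ _.
have key t : t * G * (1 - L * t / 2) <= f x - fmin.
  have := le_trans (fmin_le _) (smooth_descent x (- t *: grad f x) df sf).
  rewrite !dotvE -/G => ?; lra.
have G0 : 0 <= G := dotv_ge0 _.
have gap0 : 0 <= f x - fmin by rewrite subr_ge0.
have [L_gt0|] := ltrP 0 L.
  have := key L^-1; rewrite divff ?gt_eqF // => h.
  have : L^-1 * G <= 2 * (f x - fmin) by lra.
  by rewrite ler_pdivrMl // => h'; rewrite (le_trans h') // mulrA (mulrC L).
move=> Lle; have L00 : L = 0 by apply/eqP; rewrite eq_le Lle.
have [Gp|] := ltrP 0 G; last by rewrite L00 mulr0 mul0r.
(* For L = 0 the bound reads t G <= f x - fmin for every t; this t violates it when G > 0. *)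
have := key ((f x - fmin + 1) / G).
rewrite L00 mul0r mul0r subr0 mulr1 divfK ?gt_eqF //; lra.
Qed.

(** At xstar + h the two properties give mu / 2 |h|^2 <= <grad f, h> <= L |h|^2. Keeping |h|^2 on
    both sides covers h = 0; mu <= 2 L follows as soon as a nonzero h exists. *)
Lemma quasi_strongly_convex_le f (L mu : R) xstar h : 0 <= L ->
  (forall y, differentiable f y) -> smooth f L -> (forall y, f xstar <= f y) ->
  quasi_strongly_convex f xstar mu ->
  mu * dotv h h <= 2 * L * dotv h h.
Proof.
move=> L0 df sf fmin qsc.
have g0 : grad f xstar = 0.
  apply: dotv_eq0; apply/eqP; rewrite eq_le dotv_ge0 andbT.
  by have := smooth_grad_sqr_le xstar L0 df sf fmin; rewrite subrr mulr0.
have xsD : xstar + h - xstar = h by rewrite addrAC subrr add0r.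
have := qsc (xstar + h).
rewrite opprD addNKr xsD sqr_enorm dotvNr.
have := dotv_le_enorm (grad f (xstar + h)) h.
have := sf (xstar + h) xstar; rewrite g0 subr0 xsD.
have := fmin (xstar + h); have := enorm_ge0 h.
rewrite -sqr_enorm expr2.
move: (enorm h) (enorm (grad f (xstar + h))) => p q p0 h0 h1 h2 h3.
have : q * p <= L * p * p by rewrite ler_wpM2r.
lra.
Qed.

End gradient.

(** * Borel measurability of row vectors *)

Section borel_row_vectors.
Variables (R : realType) (d : nat).

Lemma continuous_measurable_borel (h : borel_rV R d -> R) :
  continuous (h : 'rV[R]_d -> R) -> measurable_fun setT h.
Proof.
move=> /continuousP ch; apply: (measurability _ (RGenOpens.measurableE R)).
move=> _ [_ [a [b ->] <-]]; rewrite setTI; apply: sub_sigma_algebra.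
exact/ch/interval_open.
Qed.

Lemma measurable_coord (j : 'I_d) :
  measurable_fun setT (fun x : borel_rV R d => (x : 'rV[R]_d) 0 j).
Proof. by apply: continuous_measurable_borel; exact: coord_continuous. Qed.

(** A countable cover of an open set by cubes with rational centre and radius 1 / (k + 1). The
    second condition on x keeps a cube only if it lies inside U, so the index set does not depend on
    U. *)
Lemma open_rV_rat_balls (U : set 'rV[R]_d) : open U ->
  U = \bigcup_(c : 'rV[rat]_d * nat)
    [set x | (forall j, `|ratr (c.1 0 j) - x 0 j| < (c.2.+1%:R)^-1 :> R) /\
      forall y : 'rV[R]_d, (forall j, `|ratr (c.1 0 j) - y 0 j| < (c.2.+1%:R)^-1 :> R)
        -> U y].
Proof.
move=> oU; apply/seteqP; split=> [x Ux|x [[q k] _ /= [xq]]]; last exact.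
have /nbhs_ballP[e e0 eU] : nbhs x U by rewrite nbhsE; exists U.
(* The factor 2 pays for the triangle inequality through the rational centre. *)
have [k ke] : exists k : nat, (k.+1%:R)^-1 * 2 < e.
  exists (Num.truncn (e^-1 * 2)).
  rewrite mulrC ltr_pdivrMr ?ltr0Sn // -ltr_pdivrMl //.
  exact: truncnS_gt.
have rk0 : 0 < (k.+1%:R)^-1 :> R by rewrite invr_gt0 ltr0Sn.
have qP j : {q : rat | `|ratr q - x 0 j| < (k.+1%:R)^-1}.
  apply: cid; have lt : x 0 j < x 0 j + (k.+1%:R)^-1 by rewrite ltrDl.
  have [q /itvP qx] := rat_in_itvoo lt; exists q.
  by rewrite ger0_norm ?subr_ge0 ?qx // ltrBlDl qx.
exists (\row_j sval (qP j), k) => //=; split=> [j|y qy].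
  by rewrite mxE; case: (qP j).
apply: eU; split=> // i j; rewrite !ord1 -ball_normE /=.
have := qy j; rewrite mxE; case: (qP j) => q /= xq yq.
rewrite (_ : x 0 j - y 0 j = (x 0 j - ratr q) + (ratr q - y 0 j)); last by rewrite addrA subrK.
apply: (le_lt_trans (ler_normD _ _)); apply: lt_trans ke.
by rewrite mulr2n mulrDr mulr1 ltrD // distrC.
Qed.

(** Preimages of open sets suffice; the countable cover by cubes reduces them to conditions on
    finitely many coordinates. *)
Lemma measurable_rowP dT (T : measurableType dT) (X : T -> borel_rV R d) :
  (forall j, measurable_fun setT (fun t => (X t : 'rV[R]_d) 0 j)) ->
  measurable_fun setT X.
Proof.
move=> mX.
apply: (@measurability _ _ T (borel_rV R d) setT X (@open 'rV[R]_d)) => // _ [U oU <-].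
rewrite setTI (open_rV_rat_balls oU) preimage_bigcup.
apply: countable_bigcupT_measurable; first exact: countableP.
move=> [q k] /=.
have [sU|nU] := pselect (forall y : 'rV[R]_d,
    (forall j, `|ratr (q 0 j) - y 0 j| < (k.+1%:R)^-1 :> R) -> U y); last first.
  by rewrite (_ : _ @^-1` _ = set0) //; apply/seteqP; split=> // t [].
rewrite (_ : _ @^-1` _ = \bigcap_(j in [set: 'I_d])
    [set t | `|ratr (q 0 j) - (X t : 'rV[R]_d) 0 j| < (k.+1%:R)^-1]).
  apply: fin_bigcap_measurable => // j _.
  have mg : measurable_fun setT
      (fun t => `|ratr (q 0 j) - (X t : 'rV[R]_d) 0 j| : R).
    by apply: measurableT_comp => //; apply: measurable_funB => //; exact: mX.
  have := mg measurableT _ (measurable_itv `]-oo, (k.+1%:R)^-1[).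
  by rewrite setTI; congr measurable; apply/seteqP; split=> t; rewrite /= in_itv.
apply/seteqP; split=> [t [h _] j _|t h]; first exact: h.
by split=> // j; exact: h.
Qed.

End borel_row_vectors.

Section vector_measurability.
Variables (R : realType) (d : nat) (dT : measure_display) (T : measurableType dT).
Implicit Types X Y : T -> borel_rV R d.

Lemma measurable_row_entry X j : measurable_fun setT X ->
  measurable_fun setT (fun t => (X t : 'rV[R]_d) 0 j).
Proof. exact: (measurableT_comp (measurable_coord j)). Qed.

Lemma measurable_rowD X Y : measurable_fun setT X -> measurable_fun setT Y ->
  measurable_fun setT ((fun t => X t + Y t) : T -> borel_rV R d).
Proof.
move=> mX mY; apply: measurable_rowP => j; under eq_fun do rewrite mxE.
by apply: measurable_funD; exact: measurable_row_entry.
Qed.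

Lemma measurable_rowZ X (a : T -> R) : measurable_fun setT a ->
  measurable_fun setT X ->
  measurable_fun setT ((fun t => a t *: X t) : T -> borel_rV R d).
Proof.
move=> ma mX; apply: measurable_rowP => j; under eq_fun do rewrite mxE.
by apply: measurable_funM => //; exact: measurable_row_entry.
Qed.

Lemma measurable_rowB X Y : measurable_fun setT X -> measurable_fun setT Y ->
  measurable_fun setT ((fun t => X t - Y t) : T -> borel_rV R d).
Proof.
move=> mX mY; apply: measurable_rowP => j; under eq_fun do rewrite mxE mxE.
by apply: measurable_funB; exact: measurable_row_entry.
Qed.

Lemma measurable_row_sum I (r : seq I) (X : I -> T -> borel_rV R d) :
  (forall i, measurable_fun setT (X i)) ->
  measurable_fun setT ((fun t => \sum_(i <- r) (X i t : 'rV[R]_d)) : T -> borel_rV R d).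
Proof.
move=> mX; apply: measurable_rowP => j; under eq_fun do rewrite summxE.
by apply: measurable_sum => i; exact: measurable_row_entry.
Qed.

Lemma measurable_dotv X Y : measurable_fun setT X -> measurable_fun setT Y ->
  measurable_fun setT (fun t => dotv (X t) (Y t)).
Proof.
move=> mX mY; apply: measurable_sum => j.
by apply: measurable_funM; exact: measurable_row_entry.
Qed.

End vector_measurability.

(** The f_ij are differentiable but their gradients may be discontinuous. Each partial derivative is
    a pointwise limit of continuous difference quotients with increments 1 / (k + 1). *)
Lemma measurable_grad (R : realType) (d : nat) (h : 'rV[R]_d -> R) :
  (forall x, differentiable h x) ->
  measurable_fun setT (grad h : borel_rV R d -> borel_rV R d).
Proof.
move=> dh; apply: measurable_rowP => j; under eq_fun do rewrite mxE.
have ch : continuous h by move=> x; exact: differentiable_continuous.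
pose t (k : nat) : R := (k.+1%:R)^-1.
apply: (@measurable_fun_cvg _ _ _ setT
  (fun k (x : borel_rV R d) => (t k)^-1 * (h (t k *: delta_mx 0 j + x) - h x))).
- move=> k; apply: measurable_funM => //; apply: measurable_funB.
    apply: continuous_measurable_borel => x.
    apply: (@continuous_comp _ _ _ (fun y : 'rV[R]_d => t k *: delta_mx 0 j + y) h).
      apply: (@continuousD _ _ _ (cst _) id); [exact: cst_continuous|exact: cvg_id].
    exact: ch.
  exact: continuous_measurable_borel.
- move=> x _.
  have /= := @diff_derivable _ _ _ h x (delta_mx 0 j) (dh x).
  rewrite /derivable /derive => /cvg_ex[/= l hl]; rewrite (cvg_lim _ hl) //.
  move/cvgr_dnbhsP: hl => /(_ t); apply; split=> [k|].
    by rewrite invr_eq0 pnatr_eq0.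
  exact: cvg_harmonic.
Qed.

(** * Independence *)

Section independent_pair.
Local Open Scope ereal_scope.
Variables (R : realType) (dO d1 d2 : measure_display).
Variables (Omega : measurableType dO) (T1 : measurableType d1) (T2 : measurableType d2).
Variable P : probability Omega R.
Variables (X : Omega -> T1) (Y : Omega -> T2).
Hypotheses (mX : measurable_fun setT X) (mY : measurable_fun setT Y).
Hypothesis indepXY : forall A B, measurable A -> measurable B ->
  P (X @^-1` A `&` Y @^-1` B) = P (X @^-1` A) * P (Y @^-1` B).

(** Independence on rectangles identifies the joint law with the product of the two laws; Tonelli's
    theorem then iterates the integral. *)
Lemma ge0_integral_indep (F : T1 * T2 -> \bar R) :
  measurable_fun setT F -> (forall z, 0 <= F z) ->
  \int[P]_w F (X w, Y w) = \int[P]_w \int[P]_w' F (X w, Y w').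
Proof.
move=> mF F0.
pose X' : {mfun Omega >-> T1} := HB.pack X (isMeasurableFun.Build _ _ _ _ X mX).
pose Y' : {mfun Omega >-> T2} := HB.pack Y (isMeasurableFun.Build _ _ _ _ Y mY).
have mXY : measurable_fun setT (fun w => (X w, Y w)) by exact: measurable_fun_pair.
pose XY : {mfun Omega >-> (T1 * T2)%type} :=
  HB.pack (fun w => (X w, Y w)) (isMeasurableFun.Build _ _ _ _ _ mXY).
have -> : \int[P]_w F (X w, Y w) = \int[distribution P XY]_z F z.
  by rewrite ge0_integral_distribution.
have -> : \int[distribution P XY]_z F z
    = \int[distribution P X' \x distribution P Y']_z F z.
  apply: eq_measure_integral => /= A mA _.
  apply: esym; exact: product_measure_unique.
rewrite fubini_tonelli1 // /fubini_F.
rewrite (ge0_integral_distribution X').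
- apply: eq_integral => w _ /=.
  rewrite (ge0_integral_distribution Y') //.
  apply: (measurableT_comp mF); exact: pair1_measurable.
- exact: measurable_fun_fubini_tonelli_F.
- by move=> x; apply: integral_ge0.
Qed.

(** This plays the role of a conditional expectation: the inner integral is bounded for each frozen
    value of [X], and the bound is integrated. *)
Lemma ge0_integral_indep_le (F : T1 * T2 -> \bar R) (G : Omega -> \bar R) :
  measurable_fun setT F -> (forall z, 0 <= F z) -> measurable_fun setT G ->
  (forall w, \int[P]_w' F (X w, Y w') <= G w) ->
  \int[P]_w F (X w, Y w) <= \int[P]_w G w.
Proof.
move=> mF F0 mG FG; rewrite ge0_integral_indep //.
apply: ge0_le_integral => //; first by move=> w _; exact: integral_ge0.
pose Y' : {mfun Omega >-> T2} := HB.pack Y (isMeasurableFun.Build _ _ _ _ Y mY).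
rewrite (_ : (fun w => _) = fubini_F (distribution P Y') F \o X).
  by apply: measurableT_comp => //; exact: measurable_fun_fubini_tonelli_F.
apply/funext => w /=; rewrite /fubini_F (ge0_integral_distribution Y') //.
by apply: (measurableT_comp mF); exact: pair1_measurable.
Qed.

End independent_pair.

(* For disjoint A and B the diagonal map from Omega to the product of the two
   cylinder spaces carries P to a product measure, so the noise indexed by B can be
   integrated while everything that depends on the noise indexed by A is frozen. *)
Section independent_families.
Variables (R : realType) (dO : measure_display) (Omega : measurableType dO).
Variables (P : probability Omega R) (I : choiceType) (F : I -> set (set Omega)).
Hypothesis FT : forall a, F a setT.
Hypothesis FI : forall a, setI_closed (F a).
Hypothesis Fm : forall a, F a `<=` measurable.

(** A pi-system that generates the sigma-algebra of the noise with index in [A]. Each cylinder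
    constrains finitely many indices, while [A] may be infinite. *)
Definition cylinders (A : set I) : set (set Omega) :=
  [set E | exists (J : {fset I}) (G : I -> set Omega),
    [/\ forall a, a \in J -> A a, forall a, F a (G a)
      & E = \bigcap_(a in [set` J]) G a]].

Lemma cylinders_single (A : set I) a E : A a -> F a E -> cylinders A E.
Proof.
move=> Aa FE; exists [fset a]%fset, (fun b => if b == a then E else setT); split.
- by move=> b; rewrite inE => /eqP ->.
- by move=> b; case: eqP => [->|].
- apply/seteqP; split=> [w Ew b /=|w /(_ a)/=]; last first.
    by rewrite eqxx; apply; rewrite inE.
  by case: eqP.
Qed.

Lemma cylinders_setI (A : set I) : setI_closed (cylinders A).
Proof.
move=> _ _ [J1 [G1 [JA1 FG1 ->]]] [J2 [G2 [JA2 FG2 ->]]].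
exists (J1 `|` J2)%fset, (fun a => (if a \in J1 then G1 a else setT)
    `&` (if a \in J2 then G2 a else setT)); split.
- by move=> a; rewrite inE => /orP[/JA1|/JA2].
- by move=> a; apply: FI; case: ifP.
- apply/seteqP; split=> [w [w1 w2] a _ /=|w h].
    by split; case: ifP => // aJ; [exact: w1|exact: w2].
  split=> a /= aJ.
    by have := h a; rewrite /= inE aJ /= => /(_ isT)[].
  by have := h a; rewrite /= inE aJ orbT /= => /(_ isT)[].
Qed.

Lemma cylinders_setT (A : set I) : cylinders A setT.
Proof.
exists fset0, (fun=> setT); split=> //.
by apply/seteqP; split.
Qed.

Lemma cylinders_measurable (A : set I) : cylinders A `<=` measurable.
Proof.
move=> _ [J [G [_ FG ->]]]; apply: fin_bigcap_measurable.
  exact: finite_fset.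
by move=> a _; exact: Fm (FG a).
Qed.

Hypothesis indepF : mutually_independent P F.

(** Over disjoint index sets the intersection of two cylinders is a cylinder over the union, whose
    product of probabilities splits in two. *)
Lemma cylinders_indep (A B : set I) E1 E2 : A `&` B = set0 ->
  cylinders A E1 -> cylinders B E2 -> P (E1 `&` E2) = (P E1 * P E2)%E.
Proof.
move=> AB [J1 [G1 [JA FG1 ->]]] [J2 [G2 [JB FG2 ->]]].
have nJ a : a \in J1 -> a \in J2 -> False.
  move=> /JA Aa /JB Ba; have : (A `&` B) a by split.
  by rewrite AB.
pose G a := if a \in J1 then G1 a else G2 a.
have FG a : F a (G a) by rewrite /G; case: ifP.
have -> : \bigcap_(a in [set` J1]) G1 a `&` \bigcap_(a in [set` J2]) G2 a
    = \bigcap_(a in [set` (J1 `|` J2)%fset]) G a.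
  apply/seteqP; split=> [w [w1 w2] a /=|w h].
    rewrite inE /G; case: ifP => [aJ _|_ /= aJ]; [exact: w1|exact: w2].
  split=> a /= aJ; have := h a; rewrite /= inE aJ ?orbT => /(_ isT); rewrite /G.
    by rewrite aJ.
  by case: ifP => // /nJ /(_ aJ).
rewrite indepF; last by move=> a _; exact: FG.
rewrite (indepF (J := J1)); last by move=> a _; exact: FG1.
rewrite (indepF (J := J2)); last by move=> a _; exact: FG2.
rewrite (@perm_big _ _ _ _ _ (enum_fset J1 ++ enum_fset J2)) /=; last first.
  apply: uniq_perm; rewrite ?cat_uniq ?fset_uniq //=.
    rewrite andbT; apply/hasPn => a a2; apply/negP => a1; exact: (nJ a).
  by move=> a; rewrite mem_cat !inE.
rewrite big_cat /=.
congr (_ * _)%E; rewrite big_seq [RHS]big_seq; apply: eq_bigr => a aJ.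
  by rewrite /G aJ.
by rewrite /G; case: ifP => // /nJ /(_ aJ).
Qed.

(** For fixed [E2], both sides are finite measures in [E1] that agree on the pi-system [C], hence on
    the sigma-algebra it generates. *)
Lemma indep_g_sigma (C : set (set Omega)) (E2 : set Omega) :
  C `<=` measurable -> setI_closed C -> C setT -> measurable E2 ->
  (forall E1, C E1 -> P (E1 `&` E2) = (P E1 * P E2)%E) ->
  forall E1, <<s C >> E1 -> P (E1 `&` E2) = (P E1 * P E2)%E.
Proof.
move=> Cm CI CT mE2 CE E1 sE1.
have fP : P E2 \is a fin_num by exact: fin_num_measure.
have c0 : 0 <= fine (P E2) by rewrite fine_ge0.
have mscaleE E : mscale (NngNum c0) P E = (P E * P E2)%E.
  by rewrite muleC -[in RHS](fineK fP).
have : mrestr P mE2 E1 = mscale (NngNum c0) P E1.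
  apply: (@g_sigma_algebra_measure_unique _ R Omega C Cm (fun=> setT)) => //.
  - by rewrite bigcup_const.
  - by move=> E CE1; apply: (eq_trans (CE _ CE1)); apply: esym; exact: mscaleE.
  - move=> _; rewrite -[X in (X < _)%E]/(P (setT `&` E2)) setTI.
    by rewrite (le_lt_trans (probability_le1 P mE2)) // ltry.
by move=> h; apply: (eq_trans h); exact: mscaleE.
Qed.

(** The pi-system argument is used once in each variable: against a fixed cylinder over [B], then
    against a fixed event generated by [A]. *)
Lemma sigma_cylinders_indep (A B : set I) E1 E2 : A `&` B = set0 ->
  <<s cylinders A >> E1 -> <<s cylinders B >> E2 ->
  P (E1 `&` E2) = (P E1 * P E2)%E.
Proof.
move=> AB sE1 sE2.
have sm : <<s cylinders A >> `<=` @measurable _ Omega.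
  by apply: smallest_sub; [exact: sigma_algebra_measurable|exact: cylinders_measurable].
rewrite setIC muleC.
apply: (indep_g_sigma (@cylinders_measurable B) (@cylinders_setI B)
  (cylinders_setT B) (sm _ sE1) _ sE2) => E CE.
rewrite setIC muleC.
apply: (indep_g_sigma (@cylinders_measurable A) (@cylinders_setI A)
  (cylinders_setT A) (cylinders_measurable CE) _ sE1) => E' CE'.
exact: (cylinders_indep AB).
Qed.

Notation Omega_ A := (g_sigma_algebraType (cylinders A)).

Lemma measurable_id_cylinders (A : set I) :
  measurable_fun setT (id : Omega -> Omega_ A).
Proof.
apply: (@measurability _ _ Omega (Omega_ A) setT id (cylinders A)) => // _ [E CE <-].
by rewrite setTI; exact: cylinders_measurable CE.
Qed.

Lemma integral_indep_families_le (A B : set I)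
    (H : Omega_ A * Omega_ B -> \bar R) (G : Omega -> \bar R) :
  A `&` B = set0 -> measurable_fun setT H -> (forall z, 0 <= H z)%E ->
  measurable_fun setT G -> (forall w, \int[P]_w' H (w, w') <= G w)%E ->
  (\int[P]_w H (w, w) <= \int[P]_w G w)%E.
Proof.
move=> AB mH H0 mG HG.
apply: (@ge0_integral_indep_le _ _ _ _ Omega (Omega_ A) (Omega_ B) P id id) => //.
- exact: measurable_id_cylinders.
- exact: measurable_id_cylinders.
- by move=> E1 E2 mE1 mE2; exact: (sigma_cylinders_indep AB).
Qed.

Lemma measurable_cylinders (A : set I) a (dT : measure_display)
    (T : measurableType dT) (X : Omega -> T) :
  A a -> sigma_of X `<=` F a -> measurable_fun setT (X : Omega_ A -> T).
Proof.
move=> Aa XF _ B mB; apply: sub_sigma_algebra; apply: (cylinders_single Aa).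
by apply: XF; exists B.
Qed.

End independent_families.

Notation cylinder_space F A := (g_sigma_algebraType (cylinders F A)).

(** * Second moments of independent sums *)

Section second_moments.
Variables (R : realType) (dO : measure_display) (Omega : measurableType dO).
Variable P : probability Omega R.
Implicit Types f g : Omega -> R.

Notation integ f := (P.-integrable setT (EFin \o f)).

Lemma integral_EFin_Rintegral f : integ f ->
  (\int[P]_w (f w)%:E = (\int[P]_w f w)%R%:E)%E.
Proof. by move=> fi; rewrite /Rintegral fineK //; exact: integrable_fin_num. Qed.

Lemma integ_cst (c : R) : integ (fun=> c).
Proof. exact: finite_measure_integrable_cst. Qed.

Lemma integD f g : integ f -> integ g -> integ (fun w => f w + g w).
Proof. by move=> fi gi; exact: (integrableD measurableT fi gi). Qed.

Lemma integB f g : integ f -> integ g -> integ (fun w => f w - g w).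
Proof. by move=> fi gi; exact: (integrableB measurableT fi gi). Qed.

Lemma integZ (c : R) f : integ f -> integ (fun w => c * f w).
Proof. by move=> fi; exact: (integrableZl measurableT c fi). Qed.

Lemma integ_sum I (r : seq I) (F : I -> Omega -> R) :
  (forall i, integ (F i)) -> integ (fun w => \sum_(i <- r) F i w).
Proof.
move=> Fi; elim: r => [|i r IHr].
  by under eq_fun do rewrite big_nil; exact: integ_cst.
under eq_fun do rewrite big_cons; exact: integD.
Qed.

Lemma Rintegral_sum I (r : seq I) (F : I -> Omega -> R) :
  (forall i, integ (F i)) ->
  \int[P]_w (\sum_(i <- r) F i w) = \sum_(i <- r) \int[P]_w F i w.
Proof.
move=> Fi; elim: r => [|i r IHr].
  by under eq_Rintegral do rewrite big_nil; rewrite big_nil Rintegral_cst // mul0r.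
under eq_Rintegral do rewrite big_cons.
by rewrite RintegralD // ?IHr ?big_cons //; exact: integ_sum.
Qed.

Lemma Rintegral_cst1 (c : R) : \int[P]_w c = c.
Proof. by rewrite Rintegral_cst // [X in fine X](probability_setT P) mulr1. Qed.

Lemma integ_le f g : measurable_fun setT f -> (forall w, `|f w| <= g w) ->
  integ g -> integ f.
Proof.
move=> mf fg gi; apply: (@le_integrable _ _ _ P setT measurableT _ (EFin \o g)) => //.
  exact/measurable_EFinP.
by move=> w _ /=; rewrite lee_fin (le_trans (fg w)) // ler_norm.
Qed.

Lemma sqr_integ f : measurable_fun setT f -> integ (fun w => f w ^+ 2) -> integ f.
Proof.
move=> mf fi; apply: (integ_le mf _ (integD (integ_cst 1) fi)) => w.
have := sqr_ge0 (`|f w| - 1); rewrite sqrrB real_normK ?num_real //.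
have := normr_ge0 (f w); lra.
Qed.

Lemma integ_mul f g : measurable_fun setT f -> measurable_fun setT g ->
  integ (fun w => f w ^+ 2) -> integ (fun w => g w ^+ 2) ->
  integ (fun w => f w * g w).
Proof.
move=> mf mg fi gi; apply: (integ_le _ _ (integD fi gi)) => [|w].
  exact: measurable_funM.
rewrite ler_norml; have := sqr_ge0 (f w - g w); have := sqr_ge0 (f w + g w).
have := sqr_ge0 (f w); have := sqr_ge0 (g w).
by rewrite sqrrB sqrrD => *; apply/andP; split; lra.
Qed.

Lemma sqr_integD f g : measurable_fun setT f -> measurable_fun setT g ->
  integ (fun w => f w ^+ 2) -> integ (fun w => g w ^+ 2) ->
  integ (fun w => (f w + g w) ^+ 2).
Proof.
move=> mf mg fi gi; apply: (integ_le _ _ (integD (integZ 2 fi) (integZ 2 gi))).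
  by apply: measurable_funX; exact: measurable_funD.
move=> w; rewrite ger0_norm ?sqr_ge0 //.
have := sqr_ge0 (f w - g w); rewrite sqrrB sqrrD; lra.
Qed.

Lemma sqr_integ_sum I (r : seq I) (F : I -> Omega -> R) :
  (forall i, measurable_fun setT (F i)) ->
  (forall i, integ (fun w => F i w ^+ 2)) ->
  integ (fun w => (\sum_(i <- r) F i w) ^+ 2).
Proof.
move=> mF Fi; elim: r => [|i r IHr].
  by under eq_fun do rewrite big_nil; exact: integ_cst.
under eq_fun do rewrite big_cons.
by apply: sqr_integD => //; exact: measurable_sum.
Qed.

Lemma sqr_integZ (c : R) f : integ (fun w => f w ^+ 2) ->
  integ (fun w => (c * f w) ^+ 2).
Proof. by move=> fi; under eq_fun do rewrite exprMn; exact: integZ. Qed.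

(* Only Tonelli's theorem is available for the pair, hence the detour through
   the nonnegative function [(f + g)^2]. *)
Lemma Rintegral_mul_indep (d1 d2 : measure_display) (T1 : measurableType d1)
    (T2 : measurableType d2) (X : Omega -> T1) (Y : Omega -> T2)
    (phi : T1 -> R) (psi : T2 -> R) :
  measurable_fun setT X -> measurable_fun setT Y ->
  (forall A B, measurable A -> measurable B ->
    P (X @^-1` A `&` Y @^-1` B) = (P (X @^-1` A) * P (Y @^-1` B))%E) ->
  measurable_fun setT phi -> measurable_fun setT psi ->
  integ (fun w => phi (X w) ^+ 2) -> integ (fun w => psi (Y w) ^+ 2) ->
  \int[P]_w (phi (X w) * psi (Y w))
    = \int[P]_w (phi (X w)) * \int[P]_w (psi (Y w)).
Proof.
move=> mX mY indep mphi mpsi f2 g2.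
have mf : measurable_fun setT (fun w => phi (X w)) by exact: measurableT_comp.
have mg : measurable_fun setT (fun w => psi (Y w)) by exact: measurableT_comp.
have f1 := sqr_integ mf f2; have g1 := sqr_integ mg g2.
have fg := integ_mul mf mg f2 g2.
set m1 := \int[P]_w (phi (X w)); set m2 := \int[P]_w (psi (Y w)).
set s1 := \int[P]_w (phi (X w) ^+ 2); set s2 := \int[P]_w (psi (Y w) ^+ 2).
pose F (z : T1 * T2) : \bar R := ((phi z.1 + psi z.2) ^+ 2)%:E.
have mF : measurable_fun setT F.
  apply/measurable_EFinP/measurable_funX/measurable_funD.
    exact: measurableT_comp.
  exact: measurableT_comp.
have F0 z : (0 <= F z)%E by rewrite lee_fin sqr_ge0.
have := ge0_integral_indep mX mY indep mF F0; rewrite /F /=.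
have inner w : (\int[P]_w' ((phi (X w) + psi (Y w')) ^+ 2)%:E
    = (phi (X w) ^+ 2 + (2 * m2) * phi (X w) + s2)%:E)%E.
  have i1 : integ (fun w' => phi (X w) ^+ 2 + 2 * phi (X w) * psi (Y w')).
    by apply: integD; [exact: integ_cst|exact: integZ].
  under eq_integral do rewrite sqrrD -mulr_natl mulrA.
  rewrite integral_EFin_Rintegral; last exact: integD.
  rewrite RintegralD // RintegralD //; [|exact: integ_cst|exact: integZ].
  rewrite Rintegral_cst1 RintegralZl // -/m2 -/s2; congr (_%:E); ring.
under [in RHS]eq_integral do rewrite inner.
rewrite integral_EFin_Rintegral; last first.
  under eq_fun do rewrite sqrrD -mulr_natl.
  by apply: integD => //; apply: integD => //; exact: integZ.
rewrite integral_EFin_Rintegral; last first.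
  by apply: integD; [apply: integD => //; exact: integZ|exact: integ_cst].
under eq_Rintegral do rewrite sqrrD -mulr_natl.
have z1 := integZ 2 fg; have z2 := integZ (2 * m2) f1.
have c2 := integ_cst s2.
rewrite RintegralD //; last exact: integD.
rewrite RintegralD // RintegralZl // RintegralD //; last exact: integD.
rewrite RintegralD // RintegralZl // Rintegral_cst1 -/m1 -/s1 -/s2 => -[]; lra.
Qed.

(** The centred terms have mean zero, which kills the cross term with [c]. Their pairwise products
    have mean zero too, so the variances add up, and a variance is at most the second moment. *)
Lemma Rintegral_sqr_sum_le n (Y : 'I_n -> Omega -> R) (c a : R) :
  (forall i, measurable_fun setT (Y i)) ->
  (forall i, integ (fun w => Y i w ^+ 2)) ->
  (forall i j, i != j ->
    \int[P]_w (Y i w * Y j w) = \int[P]_w Y i w * \int[P]_w Y j w) ->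
  \int[P]_w ((c - a * \sum_i (Y i w - \int[P]_v Y i v)) ^+ 2)
    <= c ^+ 2 + a ^+ 2 * \sum_i \int[P]_w (Y i w ^+ 2).
Proof.
move=> mY Y2 Yij.
pose m i := \int[P]_v Y i v; pose Z i w := Y i w - m i.
have Y1 i : integ (Y i) := sqr_integ (mY i) (Y2 i).
have Zi i : integ (Z i) by apply: integB => //; exact: integ_cst.
have Z0 i : \int[P]_w Z i w = 0.
  rewrite RintegralB // ?(Rintegral_cst1 (m i)) ?subrr //; exact: integ_cst.
have YY i j : integ (fun w => Y i w * Y j w) by exact: integ_mul.
have ZZE i j w : Z i w * Z j w
    = Y i w * Y j w - m j * Y i w - m i * Y j w + m i * m j.
  by rewrite /Z; ring.
have ZZi i j : integ (fun w => Z i w * Z j w).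
  under eq_fun do rewrite ZZE.
  apply: integD (integ_cst _); apply: integB (integZ _ _) => //.
  by apply: integB (integZ _ _).
have ZZ i j : \int[P]_w (Z i w * Z j w)
    = \int[P]_w (Y i w * Y j w) - m i * m j.
  under eq_Rintegral do rewrite ZZE.
  have z1 := integZ (m j) (Y1 i); have z2 := integZ (m i) (Y1 j).
  have i1 : integ (fun w => Y i w * Y j w - m j * Y i w) by exact: integB.
  have i2 : integ (fun w => Y i w * Y j w - m j * Y i w - m i * Y j w).
    exact: integB.
  rewrite RintegralD //; last exact: integ_cst.
  rewrite RintegralB // RintegralB // [X in _ + X](Rintegral_cst1 (m i * m j)).
  rewrite !RintegralZl // -/(m i) -/(m j); ring.
have sqrE w : (c - a * \sum_i Z i w) ^+ 2
    = c ^+ 2 + (- (2 * c * a)) * (\sum_i Z i w)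
      + a ^+ 2 * \sum_i \sum_j Z i w * Z j w.
  rewrite (_ : \sum_i \sum_j Z i w * Z j w = (\sum_i Z i w) ^+ 2); first ring.
  by rewrite expr2 mulr_suml; apply: eq_bigr => i _; rewrite mulr_sumr.
under eq_Rintegral do rewrite sqrE.
have iS : integ (fun w => \sum_i Z i w) by exact: integ_sum.
have iSS : integ (fun w => \sum_i \sum_j Z i w * Z j w).
  by apply: integ_sum => i; exact: integ_sum.
have i0 := integ_cst (c ^+ 2).
have z1 := integZ (- (2 * c * a)) iS; have z2 := integZ (a ^+ 2) iSS.
rewrite RintegralD //; last exact: integD.
rewrite RintegralD // [X in X + _ + _ <= _](Rintegral_cst1 (c ^+ 2)) !RintegralZl //.
rewrite Rintegral_sum //.
rewrite big1 // mulr0 addr0 lerD2l ler_wpM2l ?sqr_ge0 // Rintegral_sum; last first.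
  by move=> i; exact: integ_sum.
apply: ler_sum => i _; rewrite Rintegral_sum // (bigD1 i) //= big1 ?addr0.
  by rewrite ZZ; under eq_Rintegral do rewrite -expr2; rewrite gerBl -expr2 sqr_ge0.
by move=> j ji; rewrite ZZ Yij ?subrr // eq_sym.
Qed.

End second_moments.

(** * One step, given the past *)

Section law_transfer.
Local Open Scope ereal_scope.
Variables (R : realType) (dO dT : measure_display).
Variables (Omega : measurableType dO) (T : measurableType dT).
Variables (P : probability Omega R) (D : probability T R) (X : {RV P >-> T}).
Hypothesis lawX : forall A, measurable A -> distribution P X A = D A.

Lemma ge0_integral_law (phi : T -> \bar R) : measurable_fun setT phi ->
  (forall t, 0 <= phi t) -> \int[D]_t phi t = \int[P]_w phi (X w).
Proof.
move=> mphi phi0; rewrite -(ge0_integral_distribution X mphi phi0).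
by apply: eq_measure_integral => A mA _; exact: esym (lawX mA).
Qed.

Lemma integral_law (phi : T -> \bar R) : measurable_fun setT phi ->
  \int[D]_t phi t = \int[P]_w phi (X w).
Proof.
move=> mphi; rewrite integralE [RHS]integralE; congr (_ - _).
  rewrite (ge0_integral_law (measurable_funepos mphi) (funepos_ge0 phi)).
  by apply: eq_integral => w _; rewrite !funeposE.
rewrite (ge0_integral_law (measurable_funeneg mphi) (funeneg_ge0 phi)).
by apply: eq_integral => w _; rewrite !funenegE.
Qed.

(** The integral is the difference of the integrals of the positive and negative parts; a finite
    value forces both to be finite. *)
Lemma integrable_of_integral (g : Omega -> R) (c : R) : measurable_fun setT g ->
  \int[P]_w (g w)%:E = c%:E -> P.-integrable setT (EFin \o g).
Proof.
move=> mg gc; have mE : measurable_fun setT (EFin \o g) by exact/measurable_EFinP.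
apply/integrableP; split=> //.
have : \int[P]_w (EFin \o g) w \is a fin_num by rewrite /= gc.
rewrite integralE fin_numB => /andP[fp fn].
rewrite (_ : (fun w => _) = (EFin \o g)^\+ \+ (EFin \o g)^\-); last first.
  by rewrite -fune_abse.
rewrite ge0_integralD //; [|exact: measurable_funepos|exact: measurable_funeneg].
by rewrite lte_add_pinfty // ltey_eq ?fp ?fn.
Qed.

End law_transfer.

Section sampled_gradients.
Variables (R : realType) (d n m : nat).
Variable fij : 'I_n -> 'I_m -> 'rV[R]_d -> R.
Hypothesis dfij : forall i j x, differentiable (fij i j) x.

Lemma grad_fsample i xi x : grad (fsample fij i xi) x
  = m%:R^-1 *: \sum_j xi 0 j *: grad (fij i j) x.
Proof. by apply: grad_scale_sum => j; exact: dfij. Qed.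

Lemma grad_fworker i x : grad (fworker fij i) x
  = m%:R^-1 *: \sum_j grad (fij i j) x.
Proof.
rewrite (_ : fworker fij i = fun y => m%:R^-1 * \sum_j 1 * fij i j y).
  rewrite grad_scale_sum => [|j]; last exact: dfij.
  by congr (_ *: _); apply: eq_bigr => j _; rewrite scale1r.
by apply/funext => y; congr (_ * _); apply: eq_bigr => j _; rewrite mul1r.
Qed.

Lemma differentiable_fworker i x : differentiable (fworker fij i) x.
Proof. by apply: differentiable_scale_sum => j; exact: dfij. Qed.

Lemma differentiable_fobj x : differentiable (fobj fij) x.
Proof. by apply: differentiable_scale_sum => i; exact: differentiable_fworker. Qed.

Lemma grad_fobj x : grad (fobj fij) x
  = n%:R^-1 *: \sum_i grad (fworker fij i) x.
Proof.
rewrite (_ : fobj fij = fun y => n%:R^-1 * \sum_i 1 * fworker fij i y).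
  rewrite grad_scale_sum => [|j]; last exact: differentiable_fworker.
  by congr (_ *: _); apply: eq_bigr => j _; rewrite scale1r.
by apply/funext => y; congr (_ * _); apply: eq_bigr => j _; rewrite mul1r.
Qed.

Lemma measurable_grad_fsample (dT : measure_display) (T : measurableType dT)
    i (xi : T -> borel_rV R m) (X : T -> borel_rV R d) :
  measurable_fun setT xi -> measurable_fun setT X ->
  measurable_fun setT
    ((fun t => grad (fsample fij i (xi t)) (X t)) : T -> borel_rV R d).
Proof.
move=> mxi mX; under eq_fun do rewrite grad_fsample.
apply: measurable_rowZ => //; apply: measurable_row_sum => j.
apply: measurable_rowZ; first exact: measurable_row_entry.
by apply: (measurableT_comp (@measurable_grad _ _ (fij i j) _)) => // x; exact: dfij.
Qed.

Lemma measurable_lsvrg_grad (dT : measure_display) (T : measurableType dT)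
    (xi : 'I_n -> T -> borel_rV R m) (X W : T -> borel_rV R d) i :
  measurable_fun setT (xi i) -> measurable_fun setT X -> measurable_fun setT W ->
  measurable_fun setT
    ((fun t => lsvrg_grad fij (fun i => xi i t) (X t) (W t) i) : T -> borel_rV R d).
Proof.
move=> mxi mX mW; apply: measurable_rowD.
  by apply: measurable_rowB; exact: measurable_grad_fsample.
by apply: (measurableT_comp (measurable_grad _)) => //; exact: differentiable_fworker.
Qed.

End sampled_gradients.

Section conditional_step.
Variables (R : realType) (d n m : nat).
Variable fij : 'I_n -> 'I_m -> 'rV[R]_d -> R.
Variable D : 'I_n -> probability (borel_rV R m) R.
Variables (mu L Ls : R) (xstar : 'rV[R]_d).
Hypothesis n_gt0 : (0 < n)%N.
Hypotheses (mu0 : 0 <= mu) (L0 : 0 <= L) (Ls0 : 0 < Ls).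
Hypothesis dfij : forall i j x, differentiable (fij i j) x.
Hypothesis fmin : forall x, fobj fij xstar <= fobj fij x.
Hypothesis qsc : quasi_strongly_convex (fobj fij) xstar mu.
Hypothesis smf : smooth (fobj fij) L.
Hypothesis mean1 : unit_mean_sampling D.
Hypothesis ES : expected_smoothness fij D xstar Ls.

Notation f := (fobj fij).
Notation gap x := (f x - f xstar).

Variables (dO : measure_display) (Omega : measurableType dO).
Variable P : probability Omega R.
Variable xi : 'I_n -> {RV P >-> borel_rV R m}.
Hypothesis law_xi : forall i A, measurable A -> distribution P (xi i) A = D i A.
Hypothesis indep_xi : forall i j, i != j -> forall A B, measurable A -> measurable B ->
  P (xi i @^-1` A `&` xi j @^-1` B) = (P (xi i @^-1` A) * P (xi j @^-1` B))%E.

Notation integ g := (P.-integrable setT (EFin \o g)).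

Lemma gap_ge0 x : 0 <= gap x. Proof. by rewrite subr_ge0. Qed.

Lemma grad_fobj_min : grad f xstar = 0.
Proof.
apply: dotv_eq0; apply/eqP; rewrite eq_le dotv_ge0 andbT.
have := smooth_grad_sqr_le xstar L0 (differentiable_fobj dfij) smf fmin.
by rewrite subrr mulr0.
Qed.

Definition bregman i x := fworker fij i x - fworker fij i xstar
  - dotv (grad (fworker fij i) xstar) (x - xstar).

(** The worker gradients at xstar need not vanish one by one, but they sum to n times the gradient
    of f there, which is 0; the linear terms cancel. *)
Lemma sum_bregman x : \sum_i bregman i x = n%:R * gap x.
Proof.
have nn : n%:R != 0 :> R by rewrite pnatr_eq0 -lt0n.
rewrite !sumrB -dotv_suml.
have -> : \sum_i grad (fworker fij i) xstar = 0.
  have := grad_fobj dfij xstar; rewrite grad_fobj_min => /esym/eqP.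
  by rewrite scaler_eq0 invr_eq0 (negbTE nn) => /eqP.
by rewrite dotv0l subr0 /fobj -mulrBr mulrA divff // mul1r.
Qed.

Let sg i (x : 'rV[R]_d) w := grad (fsample fij i (xi i w)) x.

Let msg i x : measurable_fun setT (sg i x : Omega -> borel_rV R d).
Proof. by apply: measurable_grad_fsample. Qed.

Lemma integ_sample i (j : 'I_m) : integ (fun w => (xi i w : 'rV[R]_m) 0 j).
Proof.
have := mean1 i j; rewrite unlock.
rewrite (integral_law (@law_xi i)); last first.
  by apply/measurable_EFinP; exact: (measurable_coord j).
apply: integrable_of_integral.
exact: (measurableT_comp (measurable_coord j)).
Qed.

Lemma Rintegral_sample i (j : 'I_m) : \int[P]_w (xi i w : 'rV[R]_m) 0 j = 1.
Proof.
have := mean1 i j; rewrite unlock.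
rewrite (integral_law (@law_xi i)); last first.
  by apply/measurable_EFinP; exact: (measurable_coord j).
by rewrite /Rintegral => ->.
Qed.

Lemma Rintegral_sample_grad i x k :
  \int[P]_w (sg i x w 0 k) = grad (fworker fij i) x 0 k.
Proof.
rewrite /sg; under eq_Rintegral do rewrite grad_fsample // mxE summxE.
have ii j : integ (fun w => ((xi i w : 'rV[R]_m) 0 j *: grad (fij i j) x) 0 k).
  under eq_fun do rewrite mxE mulrC.
  by apply: integZ; exact: integ_sample.
rewrite RintegralZl //; last exact: integ_sum.
rewrite Rintegral_sum // grad_fworker // mxE summxE; congr (_ * _).
apply: eq_bigr => j _; under eq_Rintegral do rewrite mxE.
by rewrite RintegralZr // ?Rintegral_sample ?mul1r //; exact: integ_sample.
Qed.

Lemma integ_sample_grad i x k : integ (fun w => sg i x w 0 k).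
Proof.
rewrite /sg; under eq_fun do rewrite grad_fsample // mxE summxE.
apply: integZ; apply: integ_sum => j.
under eq_fun do rewrite mxE mulrC.
by apply: integZ; exact: integ_sample.
Qed.

Lemma sample_grad_sqr_le i x :
  (\int[P]_w (dotv (sg i x w - sg i xstar w) (sg i x w - sg i xstar w))%:E
    <= (2 * Ls * bregman i x)%:E)%E.
Proof.
have := ES x i; rewrite unlock /sg; apply: le_trans.
rewrite (ge0_integral_law (@law_xi i)) /=.
- by under [leRHS]eq_integral do rewrite sqr_enorm.
- apply/measurable_EFinP; under eq_fun do rewrite sqr_enorm.
  by apply: measurable_dotv; apply: measurable_rowB;
    apply: (@measurable_grad_fsample _ _ _ _ _ dfij _ (borel_rV R m) i id) => //.
- by move=> t; rewrite lee_fin sqr_ge0.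
Qed.

Let Y i x w om := sg i x om - sg i w om.

(** Expected smoothness compares with xstar, so the gradient at xstar is inserted, at the cost of a
    factor 2. The bound also provides the square integrability needed for the variance
    computation. *)
Lemma sample_diff_sqr_le i x w :
  (\int[P]_om (dotv (Y i x w om) (Y i x w om))%:E
    <= (4 * Ls * (bregman i x + bregman i w))%:E)%E.
Proof.
pose a z om := dotv (sg i z om - sg i xstar om) (sg i z om - sg i xstar om).
have ma z : measurable_fun setT (a z).
  by apply: measurable_dotv; exact: measurable_rowB.
have a0 z om : 0 <= a z om by exact: dotv_ge0.
apply: (@le_trans _ _ (\int[P]_om (2%:E * (a x om)%:E + 2%:E * (a w om)%:E))%E).
  apply: ge0_le_integral => //.
  - by move=> om _; rewrite lee_fin dotv_ge0.
  - by apply/measurable_EFinP; apply: measurable_dotv; exact: measurable_rowB.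
  - apply: emeasurable_funD; apply: emeasurable_funM => //; exact/measurable_EFinP.
  - move=> om _; rewrite -!EFinM -EFinD lee_fin /a.
    have -> : Y i x w om = (sg i x om - sg i xstar om) - (sg i w om - sg i xstar om).
      by rewrite /Y opprB addrA subrK.
    exact: dotv_sub_le.
have mE z : measurable_fun setT (fun om => (a z om)%:E) by exact/measurable_EFinP.
have aE z om : setT om -> (0 <= (a z om)%:E)%E by rewrite lee_fin.
have mE2 z : measurable_fun setT (fun om => 2%:E * (a z om)%:E)%E.
  exact: emeasurable_funM.
have aE2 z om : setT om -> (0 <= 2%:E * (a z om)%:E)%E.
  by rewrite -EFinM lee_fin mulr_ge0.
rewrite (ge0_integralD P measurableT (aE2 x) (mE2 x) (aE2 w) (mE2 w)).
rewrite (ge0_integralZl_EFin P measurableT (aE x) (mE x)) //.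
rewrite (ge0_integralZl_EFin P measurableT (aE w) (mE w)) //.
have -> : 4 * Ls * (bregman i x + bregman i w)
  = 2 * (2 * Ls * bregman i x) + 2 * (2 * Ls * bregman i w) by ring.
by rewrite [leRHS]EFinD; apply: leeD; rewrite [leRHS]EFinM; apply: lee_wpmul2l => //;
  exact: sample_grad_sqr_le.
Qed.

(** Coordinate by coordinate, the estimator has mean grad f x and its noise is a centred sum over
    independent workers. The factor (gamma / n)^2 against n workers leaves gamma^2 / n, and summing
    over the coordinates recovers the Bregman terms. *)
Lemma lsvrg_second_moment (gamma : R) (u x w : 'rV[R]_d) :
  (\int[P]_om (let v := u - gamma *: (n%:R^-1 *: \sum_i
      lsvrg_grad fij (fun i => xi i om) x w i) in dotv v v)%:E
   <= (dotv (u - gamma *: grad f x) (u - gamma *: grad f x)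
       + gamma ^+ 2 * (4 * Ls / n%:R) * (gap x + gap w))%:E)%E.
Proof.
have nn : n%:R != 0 :> R by rewrite pnatr_eq0 -lt0n.
pose y i k om := Y i x w om 0 k.
pose c := u - gamma *: grad f x; pose a := gamma / n%:R.
have my i k : measurable_fun setT (y i k).
  by apply: measurable_row_entry; exact: measurable_rowB.
have mYY i : measurable_fun setT (fun om => dotv (Y i x w om) (Y i x w om)).
  by apply: measurable_dotv; exact: measurable_rowB.
have iYY i : integ (fun om => dotv (Y i x w om) (Y i x w om)).
  apply/integrableP; split; first exact/measurable_EFinP.
  under eq_integral do rewrite gee0_abs ?lee_fin ?dotv_ge0 //.
  exact: le_lt_trans (sample_diff_sqr_le _ _ _) (ltry _).
have iy2 i k : integ (fun om => y i k om ^+ 2).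
  apply: (integ_le _ _ (iYY i)) => [|om]; first exact: measurable_funX.
  rewrite ger0_norm ?sqr_ge0 // /dotv (bigD1 k) //= expr2 lerDl.
  by apply: sumr_ge0 => j _; rewrite -expr2 sqr_ge0.
have ymean i k : \int[P]_om (y i k om)
    = grad (fworker fij i) x 0 k - grad (fworker fij i) w 0 k.
  have yE om : y i k om = sg i x om 0 k - sg i w om 0 k by rewrite /y /Y !mxE.
  under eq_Rintegral do rewrite yE.
  rewrite RintegralB //; [|exact: integ_sample_grad|exact: integ_sample_grad].
  by rewrite !Rintegral_sample_grad.
have yindep i j k : i != j -> \int[P]_om (y i k om * y j k om)
    = \int[P]_om (y i k om) * \int[P]_om (y j k om).
  move=> ij.
  pose phi l (v : borel_rV R m) :=
    (grad (fsample fij l v) x - grad (fsample fij l v) w) 0 k.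
  have mphi l : measurable_fun setT (phi l).
    apply: (@measurable_row_entry _ _ _ _ (fun v => _)).
    by apply: measurable_rowB;
      exact: (@measurable_grad_fsample _ _ _ _ _ dfij _ (borel_rV R m) l id).
  exact: (@Rintegral_mul_indep _ _ _ P _ _ _ _ (xi i) (xi j) (phi i) (phi j)
    _ _ (indep_xi ij) (mphi i) (mphi j) (iy2 i k) (iy2 j k)).
have vE om : (let v := u - gamma *: (n%:R^-1 *: \sum_i
      lsvrg_grad fij (fun i => xi i om) x w i) in dotv v v)
    = \sum_k (c 0 k - a * \sum_i (y i k om - \int[P]_v y i k v)) ^+ 2.
  rewrite /=; apply: eq_bigr => k _; rewrite -expr2; congr (_ ^+ 2).
  (* The full gradient at the reference point w cancels the mean of the sampled one, so only the
     deviation of y from its mean survives. *)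
  have -> : \sum_i (y i k om - \int[P]_v y i k v) =
     (\sum_i lsvrg_grad fij (fun i => xi i om) x w i) 0 k
      - (\sum_i grad (fworker fij i) x) 0 k.
    rewrite !summxE -sumrB; apply: eq_bigr => i _.
    by rewrite ymean /y /Y /sg /lsvrg_grad !mxE; ring.
  rewrite /c /a (grad_fobj dfij) !mxE; ring.
have mv k : measurable_fun setT (fun om =>
    (c 0 k - a * \sum_i (y i k om - \int[P]_v y i k v)) ^+ 2).
  apply: measurable_funX; apply: measurable_funB => //.
  apply: measurable_funM => //; apply: measurable_sum => i.
  exact: measurable_funB.
under eq_integral do rewrite vE -sumEFin.
rewrite ge0_integral_sum //; first last.
- by move=> k om _; rewrite lee_fin sqr_ge0.
- by move=> k; exact/measurable_EFinP.
have iy k i : integ (y i k) by exact: sqr_integ.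
have ivk k : integ (fun om => (c 0 k - a * \sum_i (y i k om - \int[P]_v y i k v)) ^+ 2).
  under eq_fun do rewrite -mulNr.
  apply: sqr_integD => //; [|exact: integ_cst|].
    by apply: measurable_funM => //; apply: measurable_sum => i; exact: measurable_funB.
  apply: sqr_integZ; apply: sqr_integ_sum => i; first exact: measurable_funB.
  by apply: sqr_integD => //; exact: integ_cst.
under eq_bigr do rewrite integral_EFin_Rintegral //.
rewrite sumEFin lee_fin.
apply: (@le_trans _ _ (\sum_k (c 0 k ^+ 2
    + a ^+ 2 * \sum_i \int[P]_om (y i k om ^+ 2)))).
  apply: ler_sum => k _; apply: Rintegral_sqr_sum_le => //.
  by move=> i j ij; exact: yindep.
rewrite big_split /=; apply: lerD.
  by rewrite /dotv; apply: ler_sum => k _; rewrite -expr2.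
rewrite -mulr_sumr exchange_big /=.
have yb i : \sum_k \int[P]_om (y i k om ^+ 2) <= 4 * Ls * (bregman i x + bregman i w).
  rewrite -Rintegral_sum // -lee_fin -integral_EFin_Rintegral; last exact: integ_sum.
  exact: sample_diff_sqr_le.
apply: (@le_trans _ _ (a ^+ 2 * \sum_i 4 * Ls * (bregman i x + bregman i w))).
  by apply: ler_wpM2l; [exact: sqr_ge0|exact: ler_sum].
rewrite -mulr_sumr big_split /= !sum_bregman le_eqVlt; apply/orP; left; apply/eqP.
by rewrite /a; field.
Qed.

(** With x - xstar = u + e, quasi-strong convexity bounds -2 <u, grad f x> by -2 gap - mu |u + e|^2
    + 2 <e, grad f x>. Young's inequality with weight 2 L spends one gap and 2 L |e|^2 on the last
    product; passing from |u + e| to |u| costs mu |e|^2 <= 2 L |e|^2. Hence the constant 4 L. *)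
Lemma deterministic_descent (gamma : R) (x e u : 'rV[R]_d) :
  0 < gamma -> u = x - e - xstar ->
  dotv (u - gamma *: grad f x) (u - gamma *: grad f x)
    + gamma * (1 - gamma * (2 * L)) * gap x
  <= (1 - gamma * mu / 2) * dotv u u + 4 * L * gamma * dotv e e.
Proof.
move=> g0 uE.
have sq := smooth_grad_sqr_le x L0 (differentiable_fobj dfij) smf fmin.
have qe := quasi_strongly_convex_le e L0 (differentiable_fobj dfij) smf fmin qsc.
have := qsc x; rewrite sqr_enorm -opprB dotvNr => q.
have eg : 2 * dotv e (grad f x) <= 2 * L * dotv e e + gap x.
  (* The weight 2 L must be positive. For L = 0 the gradient vanishes by [sq]. *)
  have [Lp|Ln] := ltrP 0 L; last first.
    have L00 : L = 0 by apply/eqP; rewrite eq_le Ln L0.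
    have g00 : grad f x = 0.
      apply: dotv_eq0; apply/eqP; rewrite eq_le dotv_ge0 andbT.
      by move: sq; rewrite L00 mulr0 mul0r.
    by rewrite g00 dotvC dotv0l L00 !mulr0 mul0r add0r gap_ge0.
  have L2 : 0 < 2 * L by rewrite mulr_gt0.
  apply: (le_trans (dotv_young e (grad f x) L2)); rewrite lerD2l.
  by rewrite ler_pdivrMl.
have xE : x - xstar = u + e by rewrite uE addrAC subrK.
have sp : mu / 2 * dotv u u <= mu * dotv (x - xstar) (x - xstar) + mu * dotv e e.
  have := dotv_sub_le (u + e) e; rewrite addrK xE => h.
  have := ler_wpM2l mu0 h; lra.
move: q sp sq eg; rewrite xE dotvDr (dotvC (grad f x) u) (dotvC (grad f x) e).
have G0 := gap_ge0 x.
have -> : dotv (u - gamma *: grad f x) (u - gamma *: grad f x) = dotv u u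
    - gamma * (2 * dotv u (grad f x)) + gamma ^+ 2 * dotv (grad f x) (grad f x).
  by rewrite !dotvE (dotvC (grad f x) u); ring.
move=> q sp sq eg.
have h1 : - (2 * dotv u (grad f x)) + gap x
    <= - (mu / 2 * dotv u u) + 4 * L * dotv e e by lra.
have h2 := ler_wpM2l (ltW g0) h1.
have h3 := ler_wpM2l (sqr_ge0 gamma) sq.
lra.
Qed.

End conditional_step.

(** * Runs of the algorithm *)

Section measurable_run.
Variables (R : realType) (d n m : nat).
Variable fij : 'I_n -> 'I_m -> 'rV[R]_d -> R.
Hypothesis dfij : forall i j x, differentiable (fij i j) x.
Variables (dZ : measure_display) (Z : measurableType dZ).
Variable C : Z -> 'rV[R]_d -> 'rV[R]_d.
Hypothesis mC : measurable_fun [set: Z * borel_rV R d]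
  ((fun zx => C zx.1 zx.2) : Z * borel_rV R d -> borel_rV R d).
Variables (gamma : R) (x0 : 'rV[R]_d).
Variables (dT : measure_display) (T : measurableType dT).
Variables (xi : nat -> 'I_n -> T -> borel_rV R m) (zeta : nat -> 'I_n -> T -> Z).
Variable coin : nat -> T -> bool.

Definition run k t := ec_lsvrg fij gamma (fun k i => xi k i t)
  (fun k i => C (zeta k i t)) (fun k => coin k t) x0 k.

Definition run_grad k t i :=
  lsvrg_grad fij (fun i => xi k i t) (ec_x (run k t)) (ec_w (run k t)) i.

Definition run_input k t i :=
  gamma^-1 *: (ec_e (run k t) i + gamma *: run_grad k t i).

Let state_measurable k := [/\
  measurable_fun setT ((fun t => ec_x (run k t)) : T -> borel_rV R d),
  measurable_fun setT ((fun t => ec_w (run k t)) : T -> borel_rV R d)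
  & forall i, measurable_fun setT ((fun t => ec_e (run k t) i) : T -> borel_rV R d)].

Let measurable_input k i : state_measurable k -> measurable_fun setT (xi k i) ->
  measurable_fun setT ((fun t => run_input k t i) : T -> borel_rV R d).
Proof.
move=> [mx mw me] mxi; apply: measurable_rowZ => //; apply: measurable_rowD => //.
by apply: measurable_rowZ => //; exact: measurable_lsvrg_grad.
Qed.

(** [T] is generic and only the noise before step [k] is constrained. Taking for [T] the sample
    space with the sigma-algebra of the past turns the statement into adaptedness of the run. *)
Lemma measurable_run k :
  (forall k' i, (k' < k)%N -> measurable_fun setT (xi k' i)) ->
  (forall k' i, (k' < k)%N -> measurable_fun setT (zeta k' i)) ->
  (forall k', (k' < k)%N -> measurable_fun setT (coin k')) ->
  state_measurable k.
Proof.
elim: k => [|k IHk] mxi mze mco; first by split=> [||i]; exact: measurable_cst.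
have Sk : state_measurable k.
  by apply: IHk => [k' i|k' i|k'] lt; [apply: mxi|apply: mze|apply: mco]; exact: ltnW.
have [mx mw me] := Sk.
have mCk i : measurable_fun setT
    ((fun t => gamma *: C (zeta k i t) (run_input k t i)) : T -> borel_rV R d).
  apply: measurable_rowZ => //.
  apply: (@measurable_comp _ _ _ _ _ _ setT _ _
    (fun t => (zeta k i t, run_input k t i : borel_rV R d)) _ _ mC) => //.
  apply: measurable_fun_pair; first exact: mze.
  by apply: measurable_input => //; exact: mxi.
split=> [||i] /=.
- apply: measurable_rowB => //; apply: measurable_rowZ => //.
  by apply: measurable_row_sum => i; exact: mCk.
- by apply: measurable_fun_ifT => //; exact: mco.
- apply: measurable_rowB; last exact: mCk.
  apply: measurable_rowD => //; apply: measurable_rowZ => //.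
  by apply: measurable_lsvrg_grad => //; exact: mxi.
Qed.

Lemma measurable_run_input k i :
  (forall k' i, (k' < k.+1)%N -> measurable_fun setT (xi k' i)) ->
  (forall k' i, (k' < k)%N -> measurable_fun setT (zeta k' i)) ->
  (forall k', (k' < k)%N -> measurable_fun setT (coin k')) ->
  measurable_fun setT ((fun t => run_input k t i) : T -> borel_rV R d).
Proof.
move=> mxi mze mco; apply: measurable_input; last exact: mxi.
by apply: measurable_run => // k' j lt; apply: mxi; exact: ltnW.
Qed.

(** Errors do not accumulate: whatever the past, the new error is -gamma times the compression error
    at the current input. *)
Lemma run_errorS k t i : gamma != 0 -> ec_e (run k.+1 t) i
  = (- gamma) *: (C (zeta k i t) (run_input k t i) - run_input k t i).
Proof.
move=> g0; rewrite /= -/(run k t) -/(run_grad k t i) -/(run_input k t i).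
rewrite scaleNr scalerBr opprB; congr (_ - _).
by rewrite /run_input scalerA divff // scale1r.
Qed.

Definition run_virtual (xstar : 'rV[R]_d) k t : 'rV[R]_d :=
  ec_x (run k t) - n%:R^-1 *: (\sum_i ec_e (run k t) i) - xstar.

Lemma run_virtualS xstar k t : run_virtual xstar k.+1 t
  = run_virtual xstar k t - gamma *: (n%:R^-1 *: \sum_i run_grad k t i).
Proof.
pose v i := gamma *: C (zeta k i t) (run_input k t i).
have xS : ec_x (run k.+1 t) = ec_x (run k t) - n%:R^-1 *: \sum_i v i by [].
have eS i : ec_e (run k.+1 t) i
  = ec_e (run k t) i + gamma *: run_grad k t i - v i by [].
rewrite /run_virtual xS (eq_bigr _ (fun i _ => eS i)) sumrB big_split /=.
move: (\sum_i v i) => V; rewrite -scaler_sumr.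
by apply/rowP => j; rewrite !mxE; ring.
Qed.

End measurable_run.

(** * Recursions in expectation *)

Lemma measurable_comp_fst (d1 d2 d3 : measure_display) (T1 : measurableType d1)
    (T2 : measurableType d2) (T3 : measurableType d3) (g : T1 -> T3) :
  measurable_fun setT g -> measurable_fun setT (fun z : T1 * T2 => g z.1).
Proof. by move=> mg; exact: (measurableT_comp mg measurable_fst). Qed.

Lemma measurable_comp_snd (d1 d2 d3 : measure_display) (T1 : measurableType d1)
    (T2 : measurableType d2) (T3 : measurableType d3) (g : T2 -> T3) :
  measurable_fun setT g -> measurable_fun setT (fun z : T1 * T2 => g z.2).
Proof. by move=> mg; exact: (measurableT_comp mg measurable_snd). Qed.

(** Linearity for nonnegative functions, valid before the integrals are known to be finite. *)
Lemma ge0_integral_lin (R : realType) (dT : measure_display) (T : measurableType dT)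
    (P : {measure set T -> \bar R}) (f g : T -> R) (a b : R) :
  measurable_fun setT f -> measurable_fun setT g ->
  (forall t, 0 <= f t) -> (forall t, 0 <= g t) -> 0 <= a -> 0 <= b ->
  (\int[P]_t (a * f t + b * g t)%:E
    = a%:E * \int[P]_t (f t)%:E + b%:E * \int[P]_t (g t)%:E)%E.
Proof.
move=> mf mg f0 g0 a0 b0.
have mfE : measurable_fun setT (fun t => (f t)%:E) by exact/measurable_EFinP.
have mgE : measurable_fun setT (fun t => (g t)%:E) by exact/measurable_EFinP.
have fE t : setT t -> (0 <= (f t)%:E)%E by rewrite lee_fin.
have gE t : setT t -> (0 <= (g t)%:E)%E by rewrite lee_fin.
have maf : measurable_fun setT (fun t => a%:E * (f t)%:E)%E by exact: emeasurable_funM.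
have mbg : measurable_fun setT (fun t => b%:E * (g t)%:E)%E by exact: emeasurable_funM.
have afE t : setT t -> (0 <= a%:E * (f t)%:E)%E by rewrite -EFinM lee_fin mulr_ge0.
have bgE t : setT t -> (0 <= b%:E * (g t)%:E)%E by rewrite -EFinM lee_fin mulr_ge0.
rewrite -(ge0_integralZl_EFin P measurableT fE mfE) //.
rewrite -(ge0_integralZl_EFin P measurableT gE mgE) //.
by rewrite -(ge0_integralD P measurableT afE maf bgE mbg).
Qed.

Section expected_recursions.
Variables (R : realType) (d n m : nat).
Variable fij : 'I_n -> 'I_m -> 'rV[R]_d -> R.
Variable D : 'I_n -> probability (borel_rV R m) R.
Variables (mu L Ls Delta : R) (xstar x0 : 'rV[R]_d).
Hypotheses (n_gt0 : (0 < n)%N) (m_gt0 : (0 < m)%N).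
Hypotheses (mu0 : 0 <= mu) (L0 : 0 <= L) (Ls0 : 0 < Ls).
Hypothesis dfij : forall i j x, differentiable (fij i j) x.
Hypothesis fmin : forall x, fobj fij xstar <= fobj fij x.
Hypothesis qsc : quasi_strongly_convex (fobj fij) xstar mu.
Hypothesis smf : smooth (fobj fij) L.
Hypothesis mean1 : unit_mean_sampling D.
Hypothesis ES : expected_smoothness fij D xstar Ls.

Variables (dZ : measure_display) (Z : measurableType dZ) (Q : probability Z R).
Variable C : Z -> 'rV[R]_d -> 'rV[R]_d.
Hypothesis CQ : absolute_compressor Q C Delta.
Variables (dO : measure_display) (Omega : measurableType dO).
Variable P : probability Omega R.
Variable xi : nat -> 'I_n -> {RV P >-> borel_rV R m}.
Variable zeta : nat -> 'I_n -> {RV P >-> Z}.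
Variable coin : nat -> {RV P >-> bool}.
Hypothesis noise : ec_lsvrg_noise D Q (m%:R^-1) xi zeta coin.
Variable gamma : R.
Hypothesis gamma_gt0 : 0 < gamma.

Notation f := (fobj fij).
Notation gap x := (f x - f xstar).

Definition noise_index : choiceType := (nat * 'I_n + nat * 'I_n + nat)%type.

Definition noise_sigma (a : noise_index) : set (set Omega) :=
  match a with
  | inl (inl (k, i)) => sigma_of (xi k i)
  | inl (inr (k, i)) => sigma_of (zeta k i)
  | inr k => sigma_of (coin k)
  end.

Let past k : set noise_index := [set a | match a with
  | inl (inl (l, _)) => (l < k)%N
  | inl (inr (l, _)) => (l < k)%N
  | inr l => (l < k)%N
  end].

Let samples k : set noise_index := [set a | match a with
  | inl (inl (l, _)) => l == k
  | _ => false
  end].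

Let mutual : mutually_independent P noise_sigma.
Proof. by case: noise. Qed.

Let sigmaT a : noise_sigma a setT.
Proof.
by case: a => [[[k i]|[k i]]|k] /=; exists setT => //; rewrite preimage_setT setIT.
Qed.

Let sigmaI a : setI_closed (noise_sigma a).
Proof.
have preI (dT : measure_display) (T : measurableType dT) (X : Omega -> T) :
    setI_closed (sigma_of X).
  move=> _ _ [A mA <-] [B mB <-]; exists (A `&` B); first exact: measurableI.
  by rewrite !setTI.
by case: a => [[[k i]|[k i]]|k] /=; exact: preI.
Qed.

Let sigmam a : noise_sigma a `<=` measurable.
Proof.
by case: a => [[[k i]|[k i]]|k] /= _ [A mA <-]; rewrite setTI;
  exact: measurable_funPTI.
Qed.

Notation x_ k w := (ec_x (run fij C gamma x0 xi zeta coin k w)).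
Notation w_ k w := (ec_w (run fij C gamma x0 xi zeta coin k w)).
Notation e_ k w := (ec_e (run fij C gamma x0 xi zeta coin k w)).
Notation u_ k w := (run_virtual fij C gamma x0 xi zeta coin xstar k w).
Notation y_ k w i := (run_input fij C gamma x0 xi zeta coin k w i).
Notation ebar k w := (n%:R^-1 *: (\sum_i e_ k w i)).

Let mC : measurable_fun [set: Z * borel_rV R d]
  ((fun zx => C zx.1 zx.2) : Z * borel_rV R d -> borel_rV R d).
Proof. by case: CQ. Qed.

Let mgap : measurable_fun setT ((fun x => gap x) : borel_rV R d -> R).
Proof.
apply: measurable_funB => //; apply: continuous_measurable_borel => x.
by apply: differentiable_continuous; exact: differentiable_fobj.
Qed.

Let mrun k := @measurable_run _ _ _ _ fij dfij _ _ C mC gamma x0 _ Omega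
  (fun k i => xi k i) (fun k i => zeta k i) (fun k => coin k) k
  (fun _ _ _ => measurable_funPT _) (fun _ _ _ => measurable_funPT _)
  (fun _ _ => measurable_funPT _).

Let mrun_past (A : set noise_index) k : past k `<=` A ->
  let Past := cylinder_space noise_sigma A in
  [/\ measurable_fun setT ((fun w => x_ k w) : Past -> borel_rV R d),
   measurable_fun setT ((fun w => w_ k w) : Past -> borel_rV R d) &
   forall i, measurable_fun setT ((fun w => e_ k w i) : Past -> borel_rV R d)].
Proof.
move=> pA Past.
apply: (@measurable_run _ _ _ _ fij dfij _ _ C mC gamma x0 _ (cylinder_space noise_sigma A)
  (fun k i => xi k i) (fun k i => zeta k i) (fun k => coin k)) => [l i lk|l i lk|l lk].
- by apply: (@measurable_cylinders _ _ _ _ sigmaT A (inl (inl (l, i)))) => //; exact: pA.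
- by apply: (@measurable_cylinders _ _ _ _ sigmaT A (inl (inr (l, i)))) => //; exact: pA.
- by apply: (@measurable_cylinders _ _ _ _ sigmaT A (inr l)) => //; exact: pA.
Qed.

Lemma run_error_sqr_le k i :
  (\int[P]_w (dotv (e_ k w i) (e_ k w i))%:E <= (gamma ^+ 2 * Delta ^+ 2)%:E)%E.
Proof.
case: k => [|k].
  under eq_integral do rewrite /= dotv0l.
  by rewrite integral0 lee_fin mulr_ge0 // sqr_ge0.
have g0 : gamma != 0 by rewrite gt_eqF.
(* The input of the compressor at step k depends on the past and on the samples of step k; the only
   fresh noise is the seed in [B]. *)
pose A : set noise_index := past k `|` samples k.
pose B : set noise_index := [set inl (inr (k, i))].
have AB : A `&` B = set0.
  by apply/seteqP; split=> // a [Aa Ba]; move: Aa; rewrite Ba => -[] //=; rewrite ltnn.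
pose F (z : Z) (y : 'rV[R]_d) := dotv (C z y - y) (C z y - y).
pose H (z : cylinder_space noise_sigma A * cylinder_space noise_sigma B) : \bar R :=
  (gamma ^+ 2 * F (zeta k i z.2) (y_ k z.1 i))%:E.
have mF (dT : measure_display) (T : measurableType dT) (za : T -> Z)
    (ya : T -> borel_rV R d) : measurable_fun setT za -> measurable_fun setT ya ->
    measurable_fun setT (fun t => F (za t) (ya t)).
  move=> mz my.
  have mCt : measurable_fun setT ((fun t => C (za t) (ya t)) : T -> borel_rV R d).
    apply: (@measurable_comp _ _ _ _ _ _ setT _ _
      (fun t => (za t, ya t)) _ _ mC) => //; exact: measurable_fun_pair.
  by apply: measurable_dotv; exact: measurable_rowB.
under eq_integral do rewrite run_errorS // dotvZl dotvZr mulrA -expr2 sqrrN.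
apply: (@le_trans _ _ (\int[P]_w (gamma ^+ 2 * Delta ^+ 2)%:E)%E); last first.
  by rewrite integral_cst // [X in (_ * X)%E](probability_setT P) mule1.
apply: (@integral_indep_families_le _ _ _ P _ _ sigmaT sigmaI sigmam mutual A B H) => //.
- apply/measurable_EFinP; apply: measurable_funM => //; apply: mF.
    apply: measurable_comp_snd.
    by apply: (@measurable_cylinders _ _ _ _ sigmaT B (inl (inr (k, i)))).
  apply: (@measurable_comp_fst _ _ _ _ _ _
    (fun w : cylinder_space noise_sigma A => y_ k w i : borel_rV R d)).
  apply: (@measurable_run_input _ _ _ _ fij dfij _ _ C mC gamma x0 _
    (cylinder_space noise_sigma A)
    (fun k i => xi k i) (fun k i => zeta k i) (fun k => coin k)) => [l j lk|l j lk|l lk].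
  + apply: (@measurable_cylinders _ _ _ _ sigmaT A (inl (inl (l, j)))) => //=.
    by rewrite ltnS leq_eqVlt in lk; case/orP: lk => lk; [right|left].
  + by apply: (@measurable_cylinders _ _ _ _ sigmaT A (inl (inr (l, j)))) => //=; left.
  + by apply: (@measurable_cylinders _ _ _ _ sigmaT A (inr l)) => //=; left.
- by move=> z; rewrite lee_fin mulr_ge0 ?sqr_ge0 // dotv_ge0.
- move=> w; rewrite /H /=.
  have mFz y : measurable_fun setT (fun z => (F z y)%:E).
    by apply/measurable_EFinP; exact: mF.
  under eq_integral do rewrite EFinM.
  rewrite ge0_integralZl_EFin ?sqr_ge0 //; last first.
  + exact: (measurableT_comp (mFz (y_ k w i))).
  + by move=> w' _; rewrite lee_fin dotv_ge0.
  rewrite [leRHS]EFinM; apply: lee_wpmul2l; first by rewrite lee_fin sqr_ge0.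
  case: CQ => _ /(_ (y_ k w i)); apply: le_trans.
  rewrite unlock; under [leRHS]eq_integral do rewrite sqr_enorm.
  have law : forall S, measurable S -> distribution P (zeta k i) S = Q S.
    by case: noise => _ + _ _; exact.
  by rewrite (ge0_integral_law law (mFz _)) // => z; rewrite lee_fin dotv_ge0.
Qed.

Lemma run_mean_error_sqr_le k :
  (\int[P]_w (dotv (ebar k w) (ebar k w))%:E <= (gamma ^+ 2 * Delta ^+ 2)%:E)%E.
Proof.
have [mx mw me] := mrun k.
have nn : n%:R != 0 :> R by rewrite pnatr_eq0 -lt0n.
have med i : measurable_fun setT (fun w => dotv (e_ k w i) (e_ k w i)).
  exact: measurable_dotv.
apply: (@le_trans _ _ (\int[P]_w ((n%:R^-1)%:E * \sum_i (dotv (e_ k w i) (e_ k w i))%:E))%E).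
  apply: ge0_le_integral => //.
  - by move=> w _; rewrite lee_fin dotv_ge0.
  - apply/measurable_EFinP; apply: measurable_dotv;
      by apply: measurable_rowZ => //; exact: measurable_row_sum.
  - apply: emeasurable_funM => //; apply: emeasurable_sum => i.
    exact/measurable_EFinP.
  - by move=> w _; rewrite sumEFin -EFinM lee_fin; exact: dotv_mean_le.
rewrite ge0_integralZl_EFin ?invr_ge0 ?ler0n //; last first.
- by apply: emeasurable_sum => i; exact/measurable_EFinP.
- by move=> w _; rewrite sumEFin lee_fin sumr_ge0 // => i _; exact: dotv_ge0.
rewrite ge0_integral_sum //; last first.
- by move=> i w _; rewrite lee_fin dotv_ge0.
- by move=> i; exact/measurable_EFinP.
have constE (c : R) : c = n%:R^-1 * \sum_(i < n) c.
  by rewrite sumr_const card_ord -(mulr_natl c) mulKf.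
rewrite [in leRHS](constE (gamma ^+ 2 * Delta ^+ 2)).
rewrite [leRHS]EFinM -sumEFin; apply: lee_wpmul2l; first by rewrite lee_fin invr_ge0 ler0n.
by apply: lee_sum => i _; exact: run_error_sqr_le.
Qed.

(** The coin of step k is independent of the past, which determines both candidates x_k and w_k. *)
Lemma run_reference_step k :
  (\int[P]_w (gap (w_ k.+1 w))%:E <= (m%:R^-1)%:E * \int[P]_w (gap (x_ k w))%:E
    + (1 - m%:R^-1)%:E * \int[P]_w (gap (w_ k w))%:E)%E.
Proof.
have [mx mw me] := mrun k.
have p1 : m%:R^-1 <= 1 :> R by rewrite invf_le1 ?ltr0n // ler1n.
pose A := past k; pose B : set noise_index := [set inr k].
have AB : A `&` B = set0.
  by apply/seteqP; split=> // a [Aa Ba]; move: Aa; rewrite Ba /A /= ltnn.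
pose H (z : cylinder_space noise_sigma A * cylinder_space noise_sigma B) : \bar R :=
  (if coin k z.2 then gap (x_ k z.1) else gap (w_ k z.1))%:E.
have gapE0 x : 0 <= gap x by rewrite subr_ge0.
have mgx : measurable_fun setT (fun w => gap (x_ k w)) by exact: (measurableT_comp mgap).
have mgw : measurable_fun setT (fun w => gap (w_ k w)) by exact: (measurableT_comp mgap).
rewrite -ge0_integral_lin ?subr_ge0 ?invr_ge0 ?ler0n //.
have -> : (\int[P]_w (gap (w_ k.+1 w))%:E = \int[P]_w H (w, w))%E.
  by apply: eq_integral => w _; rewrite /H /=; case: ifP.
have [pax paw _] := @mrun_past A k (fun _ h => h).
apply: (@integral_indep_families_le _ _ _ P _ _ sigmaT sigmaI sigmam mutual A B H) => //.
- apply/measurable_EFinP; apply: measurable_fun_ifT.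
  + apply: measurable_comp_snd.
    by apply: (@measurable_cylinders _ _ _ _ sigmaT B (inr k)).
  + by apply: (measurableT_comp mgap); exact: (measurable_comp_fst pax).
  + by apply: (measurableT_comp mgap); exact: (measurable_comp_fst paw).
- by move=> z; rewrite lee_fin; case: ifP.
- apply/measurable_EFinP; apply: measurable_funD; exact: measurable_funM.
- move=> w; rewrite /H /=; set a := gap (x_ k w); set b := gap (w_ k w).
  have mcoin : measurable (coin k @^-1` [set true]) by exact: measurable_funPTI.
  have cE w' : (if coin k w' then a else b)%:E
      = (b * \1_(~` (coin k @^-1` [set true])) w' + a * \1_(coin k @^-1` [set true]) w')%:E.
    rewrite !indicE in_setC /=; case: (boolP (coin k w')) => c.
      by rewrite mem_set //= mulr0 mulr1 add0r.
    rewrite memNset /= ?mulr0 ?mulr1 ?addr0 //.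
    by move=> ct; rewrite ct in c.
  under eq_integral do rewrite cE.
  have [_ _ pcoin _] := noise.
  have m1 : measurable_fun setT (\1_(coin k @^-1` [set true]) : Omega -> R).
    exact: measurable_indic.
  have m2 : measurable_fun setT (\1_(~` (coin k @^-1` [set true])) : Omega -> R).
    by apply: measurable_indic; exact: measurableC.
  have ind0 (S : set Omega) t : 0 <= \1_S t :> R by rewrite indicE ler0n.
  rewrite (ge0_integral_lin P m2 m1 (ind0 _) (ind0 _) (gapE0 _) (gapE0 _)).
  rewrite !integral_indic //; last exact: measurableC.
  rewrite !setIT [X in (_ * X + _)%E](probability_setC P mcoin) [X in (_ * (1 - X))%E]pcoin.
  rewrite [X in (_ + _ * X <= _)%E]pcoin -EFinB -!EFinM -!EFinD lee_fin le_eqVlt.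
  by apply/orP; left; apply/eqP; rewrite -/a -/b; ring.
Qed.

(** Given the past, [lsvrg_second_moment] averages over the samples of step k, and
    [deterministic_descent] bounds the mean step. The gap stays on the left because it may still be
    infinite and cannot be subtracted. *)
Lemma run_distance_step k : gamma * mu / 2 <= 1 ->
  gamma * (2 * L + 4 * Ls / n%:R) <= 1 ->
  (\int[P]_w (dotv (u_ k.+1 w) (u_ k.+1 w))%:E
    + (gamma * (1 - gamma * (2 * L + 4 * Ls / n%:R)))%:E * \int[P]_w (gap (x_ k w))%:E
   <= (1 - gamma * mu / 2)%:E * \int[P]_w (dotv (u_ k w) (u_ k w))%:E
     + (4 * L * gamma)%:E * \int[P]_w (dotv (ebar k w) (ebar k w))%:E
     + (gamma ^+ 2 * (4 * Ls / n%:R))%:E * \int[P]_w (gap (w_ k w))%:E)%E.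
Proof.
move=> gm gL.
have [mx mw me] := mrun k.
pose B := samples k; pose A := past k.
have AB : A `&` B = set0.
  apply/seteqP; split=> // -[[[l i]|[l i]]|l] [] //=.
  by move=> + /eqP lk; rewrite lk ltnn.
have gapE0 x : 0 <= gap x by rewrite subr_ge0.
have mgx : measurable_fun setT (fun w => gap (x_ k w)) by exact: (measurableT_comp mgap).
have mgw : measurable_fun setT (fun w => gap (w_ k w)) by exact: (measurableT_comp mgap).
have mebar : measurable_fun setT ((fun w => ebar k w) : Omega -> borel_rV R d).
  by apply: measurable_rowZ => //; exact: measurable_row_sum.
have mu_ : measurable_fun setT ((fun w => u_ k w) : Omega -> borel_rV R d).
  by apply: measurable_rowB => //; exact: measurable_rowB.
have [pax paw pae] := @mrun_past A k (fun _ h => h).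
pose H (z : cylinder_space noise_sigma A * cylinder_space noise_sigma B) : \bar R :=
  (let v := u_ k z.1 - gamma *: (n%:R^-1 *: \sum_i
      lsvrg_grad fij (fun i => xi k i z.2) (x_ k z.1) (w_ k z.1) i) in dotv v v)%:E.
pose v w := u_ k w - gamma *: grad f (x_ k w).
pose G w := dotv (v w) (v w)
  + gamma ^+ 2 * (4 * Ls / n%:R) * (gap (x_ k w) + gap (w_ k w)).
have mv : measurable_fun setT (v : Omega -> borel_rV R d).
  apply: measurable_rowB => //; apply: measurable_rowZ => //.
  by apply: (measurableT_comp (measurable_grad _)) => //; exact: differentiable_fobj.
have c0 : 0 <= gamma ^+ 2 * (4 * Ls / n%:R).
  by rewrite mulr_ge0 ?sqr_ge0 // divr_ge0 ?ler0n // mulr_ge0 // ltW.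
have mG : measurable_fun setT G.
  apply: measurable_funD; first exact: measurable_dotv.
  by apply: measurable_funM => //; exact: measurable_funD.
have HG : (\int[P]_w H (w, w) <= \int[P]_w (G w)%:E)%E.
  apply: (@integral_indep_families_le _ _ _ P _ _ sigmaT sigmaI sigmam mutual A B H) => //.
  - apply/measurable_EFinP.
    have mvv : measurable_fun setT ((fun z => u_ k z.1 - gamma *: (n%:R^-1 *: \sum_i
        lsvrg_grad fij (fun i => xi k i z.2) (x_ k z.1) (w_ k z.1) i)) :
        cylinder_space noise_sigma A * cylinder_space noise_sigma B -> borel_rV R d).
      apply: measurable_rowB.
        apply: measurable_comp_fst.
        apply: measurable_rowB => //; apply: measurable_rowB => //.
        by apply: measurable_rowZ => //; exact: measurable_row_sum.
      apply: measurable_rowZ => //; apply: measurable_rowZ => //.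
      apply: measurable_row_sum => i.
      have mxi : measurable_fun setT (fun z : cylinder_space noise_sigma A
          * cylinder_space noise_sigma B => xi k i z.2).
        apply: (@measurable_comp_snd _ _ _ (cylinder_space noise_sigma A)
          (cylinder_space noise_sigma B) (borel_rV R m) (xi k i)).
        by apply: (@measurable_cylinders _ _ _ _ sigmaT B (inl (inl (k, i)))) => /=.
      pose AB_ := (cylinder_space noise_sigma A * cylinder_space noise_sigma B)%type.
      have mx1 : measurable_fun setT ((fun z => x_ k z.1) : AB_ -> borel_rV R d).
        exact: (measurable_comp_fst pax).
      have mw1 : measurable_fun setT ((fun z => w_ k z.1) : AB_ -> borel_rV R d).
        exact: (measurable_comp_fst paw).
      exact: (@measurable_lsvrg_grad _ _ _ _ fij dfij _ AB_
        (fun i z => xi k i z.2) (fun z => x_ k z.1) (fun z => w_ k z.1) i mxi mx1 mw1).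
    exact: measurable_dotv.
  - by move=> z; rewrite lee_fin dotv_ge0.
  - exact/measurable_EFinP.
  - move=> w; have [law _ _ _] := noise.
    have indep i j : i != j -> forall S1 S2, measurable S1 -> measurable S2 ->
        P (xi k i @^-1` S1 `&` xi k j @^-1` S2)
        = (P (xi k i @^-1` S1) * P (xi k j @^-1` S2))%E.
      move=> ij S1 S2 mS1 mS2.
      apply: (@sigma_cylinders_indep _ _ _ P _ _ sigmaT sigmaI sigmam mutual
        [set inl (inl (k, i))] [set inl (inl (k, j))]).
      + by apply/seteqP; split=> // a [] -> [] ji; rewrite ji eqxx in ij.
      + apply: sub_sigma_algebra.
        apply: (@cylinders_single _ _ _ _ sigmaT _ (inl (inl (k, i)))) => //.
        by exists S1 => //; rewrite setTI.
      + apply: sub_sigma_algebra.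
        apply: (@cylinders_single _ _ _ _ sigmaT _ (inl (inl (k, j)))) => //.
        by exists S2 => //; rewrite setTI.
    exact: (@lsvrg_second_moment _ _ _ _ fij D L Ls xstar n_gt0 L0 dfij fmin
      smf mean1 ES _ _ P (xi k) (law k) indep gamma (u_ k w) (x_ k w) (w_ k w)).
under eq_integral do rewrite run_virtualS.
have G0 w : 0 <= G w by rewrite addr_ge0 ?dotv_ge0 // mulr_ge0 // addr_ge0.
(* The descent provides gamma (1 - 2 gamma L) gaps at x_k; the variance takes gamma^2 4 Ls / n of
   them. *)
set c := gamma * (1 - _).
have cc0 : 0 <= c by apply: mulr_ge0; [exact: ltW|rewrite subr_ge0].
apply: (@le_trans _ _ (\int[P]_w (1 * G w + c * gap (x_ k w))%:E)%E).
  by rewrite ge0_integral_lin // mul1e; exact: leeD.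
have muc : 0 <= 1 - gamma * mu / 2 by rewrite subr_ge0.
have Lc : 0 <= 4 * L * gamma by rewrite !mulr_ge0 // ltW.
have mue : measurable_fun setT (fun w => (1 - gamma * mu / 2) * dotv (u_ k w) (u_ k w)
    + (4 * L * gamma) * dotv (ebar k w) (ebar k w)).
  by apply: measurable_funD; apply: measurable_funM => //; exact: measurable_dotv.
rewrite -ge0_integral_lin //; try (exact: measurable_dotv); try (by move=> ?; exact: dotv_ge0).
rewrite -[X in (_ <= X + _)%E]mul1e -ge0_integral_lin //; last first.
  by move=> w; rewrite addr_ge0 // mulr_ge0 // dotv_ge0.
apply: ge0_le_integral => //.
- by move=> w _; rewrite lee_fin mul1r; apply: addr_ge0 => //; exact: mulr_ge0.
- by apply/measurable_EFinP; apply: measurable_funD; apply: measurable_funM.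
- by apply/measurable_EFinP; apply: measurable_funD; apply: measurable_funM.
- move=> w _; rewrite lee_fin /G /c.
  have := @deterministic_descent _ _ _ _ fij mu L xstar mu0 L0 dfij fmin qsc smf
    gamma (x_ k w) (ebar k w) (u_ k w) gamma_gt0 erefl => h.
  rewrite -/(v w); lra.
Qed.

End expected_recursions.

(** * Weights and stepsizes *)

Section weighted_recursion.
Variables (R : realType) (n m : nat) (mu L Ls Delta gamma : R).
Hypotheses (n_gt0 : (0 < n)%N) (m_gt0 : (0 < m)%N).
Hypotheses (mu0 : 0 <= mu) (L0 : 0 <= L) (Ls0 : 0 < Ls).
Hypotheses (gamma_gt0 : 0 < gamma) (gamma_le : gamma <= gamma0 n L Ls).

Let p : R := m%:R^-1.
Let eta := ec_eta gamma mu p.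
Let wt k : R := ((1 - eta) ^+ k.+1)^-1.
(* With this M, (1 - p) M + 4 Ls / n = (1 - p / 4) M. *)
Let M := 16 * m%:R * Ls / (3 * n%:R).

Let nn : 0 < n%:R :> R. Proof. by rewrite ltr0n. Qed.
Let mm : 0 < m%:R :> R. Proof. by rewrite ltr0n. Qed.

Lemma gamma0_gt0 : 0 < gamma0 n L Ls.
Proof.
by rewrite invr_gt0 ltr_wpDl ?mulr_ge0 // divr_gt0 // mulr_gt0.
Qed.

Lemma stepsize_le1 : gamma * (4 * L + 152 * Ls / (3 * n%:R)) <= 1.
Proof.
apply: le_trans (ler_wpM2r _ gamma_le) _.
  by rewrite addr_ge0 ?mulr_ge0 ?invr_ge0 // ltW // mulr_gt0.
by rewrite /gamma0 mulVf // -invr_eq0 gt_eqF // gamma0_gt0.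
Qed.

Lemma ec_eta_ge0 : 0 <= eta.
Proof.
rewrite /eta /ec_eta le_min; apply/andP; split; apply: divr_ge0 => //.
  by rewrite mulr_ge0 // ltW.
by rewrite invr_ge0 ltW.
Qed.

Lemma ec_eta_le : eta <= 4^-1.
Proof.
rewrite /eta /ec_eta ge_min; apply/orP; right.
by rewrite ler_piMl ?invr_ge0 // invf_le1 // ler1n.
Qed.

Let eta1 : 0 < 1 - eta.
Proof.
by have := ec_eta_le; rewrite subr_gt0 => /le_lt_trans; apply; rewrite invf_lt1 // ltr1n.
Qed.

Let wt_gt0 k : 0 < wt k. Proof. by rewrite invr_gt0 exprn_gt0. Qed.

(** [A], [dl] and [s] stand for the means of |u_k|^2, of the gap at x_k and of the gap at w_k. The
    noise constant arises as (2 / gamma) times 4 L gamma^3 Delta^2. *)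
Lemma weighted_recursion_le (A dl s : nat -> R) :
  (forall k, 0 <= A k) -> (forall k, 0 <= dl k) -> (forall k, 0 <= s k) ->
  (forall k, A k.+1 + gamma * (1 - gamma * (2 * L + 4 * Ls / n%:R)) * dl k
    <= (1 - gamma * mu / 2) * A k + 4 * L * gamma * (gamma ^+ 2 * Delta ^+ 2)
       + gamma ^+ 2 * (4 * Ls / n%:R) * s k) ->
  (forall k, s k.+1 <= p * dl k + (1 - p) * s k) ->
  forall K, \sum_(k < K) wt k * dl k
    <= 2 / gamma * (A 0%N + M * gamma ^+ 2 * s 0%N)
       + 8 * L * gamma ^+ 2 * Delta ^+ 2 * \sum_(k < K) wt k.
Proof.
move=> A0 dl0 s0 rA rs K.
pose T k := A k + M * gamma ^+ 2 * s k.
pose c := 4 * L * gamma * (gamma ^+ 2 * Delta ^+ 2).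
have M0 : 0 <= M by rewrite !mulr_ge0 ?invr_ge0 ?mulr_ge0 // ltW.
have Mg0 : 0 <= M * gamma ^+ 2 by apply: mulr_ge0 => //; exact: sqr_ge0.
have T0 k : 0 <= T k by apply: addr_ge0 => //; exact: mulr_ge0.
have MpE : M * p = 16 * Ls / (3 * n%:R).
  by rewrite /M /p; field; rewrite !gt_eqF.
have LsE : 4 * Ls / n%:R = 3 / 4 * (M * p) by rewrite MpE; field; rewrite gt_eqF.
have step k : T k.+1 + gamma / 2 * dl k <= (1 - eta) * T k + c.
  have g1 : eta <= gamma * mu / 2 by rewrite /eta /ec_eta ge_min lexx.
  have g2 : eta <= p / 4 by rewrite /eta /ec_eta ge_min lexx orbT.
  have h1 : eta * A k <= gamma * mu / 2 * A k by exact: ler_wpM2r.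
  have h2 : eta * (M * gamma ^+ 2 * s k) <= p / 4 * (M * gamma ^+ 2 * s k).
    by apply: ler_wpM2r => //; exact: mulr_ge0.
  have h3 := ler_wpM2l Mg0 (rs k).
  have h4 := rA k.
  (* The reference recursion adds gamma^2 M p to the coefficient of dl. Half of it must survive,
     which asks for gamma (2 L + 28 Ls / (3 n)) <= 1 / 2; gamma0 provides 76 in place of 28. *)
  have gg : gamma * (2 * L + 4 * Ls / n%:R + M * p) <= 1 / 2.
    have := stepsize_le1; rewrite LsE MpE.
    have : 0 <= gamma * (Ls / (3 * n%:R)) by rewrite mulr_ge0 ?divr_ge0 ?mulr_ge0 // ltW.
    rewrite -!mulrA; lra.
  have h5 : gamma * dl k * (gamma * (2 * L + 4 * Ls / n%:R + M * p))
      <= gamma * dl k * (1 / 2) by rewrite ler_wpM2l // mulr_ge0 // ltW.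
  move: h3 h4 h5; rewrite LsE /T /c; lra.
(* Since wt k (1 - eta) = (1 - eta)^-k, the weighted steps telescope. *)
have inv k : \sum_(j < k) wt j * (gamma / 2 * dl j) + ((1 - eta) ^+ k)^-1 * T k
    <= T 0%N + c * \sum_(j < k) wt j.
  elim: k => [|k IHk]; first by rewrite !big_ord0 expr0 invr1 mul1r add0r mulr0 addr0.
  rewrite !big_ord_recr /=.
  have := ler_wpM2l (ltW (wt_gt0 k)) (step k).
  have -> : wt k * ((1 - eta) * T k + c) = ((1 - eta) ^+ k)^-1 * T k + c * wt k.
    rewrite /wt exprS; field; rewrite (gt_eqF eta1) /=.
    by rewrite expf_neq0 // gt_eqF.
  rewrite -[((1 - eta) ^+ k.+1)^-1]/(wt k); move: IHk (T k.+1) => + t; lra.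
have := inv K.
have : 0 <= ((1 - eta) ^+ K)^-1 * T K.
  by rewrite mulr_ge0 // invr_ge0 exprn_ge0 // ltW.
have -> : \sum_(j < K) wt j * (gamma / 2 * dl j)
    = gamma / 2 * \sum_(j < K) wt j * dl j.
  by rewrite mulr_sumr; apply: eq_bigr => j _; rewrite mulrCA.
move=> h1 h2.
have h3 : gamma / 2 * \sum_(j < K) wt j * dl j <= T 0%N + c * \sum_(j < K) wt j by lra.
rewrite -(ler_pM2l (_ : 0 < gamma / 2)); last by rewrite divr_gt0.
apply: (le_trans h3); rewrite le_eqVlt; apply/orP; left; apply/eqP.
by rewrite /T /c; field; rewrite gt_eqF.
Qed.

(* The tangent of the exponential at the midpoint [K / 2] of the exponents. *)
Lemma sum_weights_ge K :
  K.+1%:R * expR (eta * K%:R / 2) <= \sum_(k < K.+1) wt k.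
Proof.
set x0 := eta * K%:R / 2.
apply: (@le_trans _ _ (\sum_(k < K.+1) expR x0 * (1 + (eta * k%:R - x0)))).
  rewrite -mulr_sumr big_split /= sumrB -mulr_sumr.
  rewrite !sumr_const card_ord.
  (* The exponents eta k have mean x0, so the linear terms of the tangents cancel in the sum. *)
  have -> : \sum_(i < K.+1) i%:R = K%:R * K.+1%:R / 2 :> R.
    elim: K => [|k IHk] in x0 *; first by rewrite big_ord1 mul0r mul0r.
    by rewrite big_ord_recr /= IHk -!natr1; field.
  rewrite le_eqVlt; apply/orP; left; apply/eqP.
  by rewrite /x0 -[1 *+ _]/(K.+1%:R) -(mulr_natl (eta * _ / 2)); field.
apply: ler_sum => k _.
apply: (@le_trans _ _ (expR (eta * k.+1%:R))).
  apply: (@le_trans _ _ (expR (eta * k%:R))).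
    rewrite -[in leRHS](subrK x0 (eta * k%:R)) expRD mulrC.
    by rewrite ler_wpM2r ?expR_ge0 // expR_ge1Dx.
  by rewrite ler_expR ler_wpM2l ?ec_eta_ge0 // ler_nat.
have base : expR eta <= (1 - eta)^-1.
  rewrite -[leLHS]invrK -expRN lef_pV2 ?posrE ?expR_gt0 //.
  exact: expR_ge1Dx.
rewrite /wt mulrC expRM_natl -exprVn; apply: lerXn2r => //.
  by rewrite nnegrE expR_ge0.
by rewrite nnegrE invr_ge0 ltW.
Qed.

End weighted_recursion.

Section stepsize_choice_strongly_convex.
Variables (R : realType) (n m K : nat) (L Ls Delta : R).
Hypotheses (n_gt0 : (0 < n)%N) (m_gt0 : (0 < m)%N) (K_gt0 : (0 < K)%N).
Hypotheses (L0 : 0 <= L) (Ls0 : 0 < Ls) (Delta0 : 0 <= Delta).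

Let nn : 0 < n%:R :> R. Proof. by rewrite ltr0n. Qed.
Let mm : 0 < m%:R :> R. Proof. by rewrite ltr0n. Qed.
Let KK : 0 < K%:R :> R. Proof. by rewrite ltr0n. Qed.
Let g0 := gamma0 n L Ls.
Let H := L + Ls / n%:R.

Let H_gt0 : 0 < H. Proof. by rewrite ltr_wpDl // divr_gt0. Qed.
Let g0_gt0 : 0 < g0. Proof. exact: gamma0_gt0. Qed.

(** 51 rounds up 152 / 3; this converts gamma0 into the quantity L + Ls / n of the rates. *)
Let g0V_le : g0^-1 <= 51 * H.
Proof.
rewrite invrK /H mulrDr; apply: lerD.
  by rewrite ler_wpM2r // ler_nat.
rewrite (_ : 152 * Ls / _ = 152 / 3 * (Ls / n%:R)); last by field; rewrite gt_eqF.
by rewrite ler_wpM2r ?divr_ge0 ?ltW //; lra.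
Qed.

Lemma ln_le_expR (x : R) : 0 < x -> x <= expR `|ln x|.
Proof. by move=> x0; rewrite -[leLHS]lnK ?posrE // ler_expR ler_norm. Qed.

Lemma ln_inv_le_expR (x : R) : 0 < x -> x^-1 <= expR `|ln x|.
Proof.
move=> x0; have xV : 0 < x^-1 by rewrite invr_gt0.
by apply: (le_trans (ln_le_expR xV)); rewrite lnV ?posrE // normrN.
Qed.

Lemma logs_ge1 (mu T : R) : 1 <= logs K n m mu L Ls Delta T.
Proof. by rewrite /logs -!addrA lerDl !addr_ge0. Qed.

(** Cleared of denominators, the claim is T mu^3 K^2 / (L Delta^2) <= exp (3 logs). Each factor x or
    1 / x is at most exp |ln x|; the highest power, mu^3, dictates the 3. *)
Lemma polylog_small (mu T : R) : 0 < mu -> 0 < L -> 0 < Delta -> 0 < T ->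
  T * mu * expR (- (3 * logs K n m mu L Ls Delta T))
    <= L * Delta ^+ 2 / (mu ^+ 2 * K%:R ^+ 2).
Proof.
move=> mu_gt0 L_gt0 D_gt0 T_gt0.
rewrite ler_pdivlMr ?mulr_gt0 ?exprn_gt0 // expRN.
rewrite -(ler_pM2r (_ : 0 < expR (3 * logs K n m mu L Ls Delta T))) ?expR_gt0 //.
rewrite -(ler_pM2l (_ : 0 < (L * Delta ^+ 2)^-1)); last first.
  by rewrite invr_gt0 mulr_gt0 // exprn_gt0.
rewrite mulrA mulrA mulVf ?mul1r; last by rewrite gt_eqF // mulr_gt0 // exprn_gt0.
set lam := logs _ _ _ _ _ _ _ _.
have -> : (L * Delta ^+ 2)^-1 * (T * mu / expR (3 * lam) * (mu ^+ 2 * K%:R ^+ 2))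
   * expR (3 * lam) = L^-1 * (Delta^-1 * Delta^-1) * (T * (mu * mu * mu) * (K%:R * K%:R)).
  by field; rewrite (gt_eqF D_gt0) (gt_eqF L_gt0) (gt_eqF (expR_gt0 _)).
apply: (@le_trans _ _ (expR `|ln L| * (expR `|ln Delta| * expR `|ln Delta|)
  * (expR `|ln T| * (expR `|ln mu| * expR `|ln mu| * expR `|ln mu|)
     * (expR `|ln (K%:R : R)| * expR `|ln (K%:R : R)|)))).
  have e0 := @expR_ge0 R.
  by do ! [apply: ler_pM; rewrite ?mulr_ge0 ?invr_ge0 ?(ltW mu_gt0) ?(ltW T_gt0)
    ?(ltW D_gt0) ?ler0n //]; first [exact: ln_inv_le_expR|exact: ln_le_expR].
rewrite -!expRD ler_expR /lam /logs.
have := normr_ge0 (ln (K%:R : R)); have := normr_ge0 (ln (n%:R : R)).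
have := normr_ge0 (ln (m%:R : R)); have := normr_ge0 (ln mu).
have := normr_ge0 (ln L); have := normr_ge0 (ln Ls).
have := normr_ge0 (ln Delta); have := normr_ge0 (ln T); lra.
Qed.

(* The stepsize is the minimum of gamma0 and 12 logs / (mu K). In the second case
   either exp (- gamma mu K / 4) = exp (- 3 logs) is absorbed by the Delta term, or
   the contraction comes from the coin; then 1 / gamma may exceed 1 / gamma0 by a
   factor K, which the factor K.+1 in the lower bound on W compensates. *)
Lemma strongly_convex_stepsize (mu T : R) : 0 < mu -> mu <= 2 * L -> 0 <= T ->
  exists gamma : R, 0 < gamma <= g0 /\
  forall W, K.+1%:R * expR (ec_eta gamma mu m%:R^-1 * K%:R / 2) <= W ->
    2 / gamma * T / W + 8 * L * gamma ^+ 2 * Delta ^+ 2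
    <= 2000 * logs K n m mu L Ls Delta T ^+ 2
        * rate_strongly_convex (204^-1) K n m mu L Ls Delta T.
Proof.
move=> mu_gt0 muL T0.
have L_gt0 : 0 < L by have := lt_le_trans mu_gt0 muL; rewrite pmulr_rgt0.
set lam := logs _ _ _ _ _ _ _ _.
have lam1 : 1 <= lam := logs_ge1 mu T.
have lam_gt0 : 0 < lam by apply: lt_le_trans lam1.
rewrite /rate_strongly_convex -/H.
set mn := Num.min (mu / H) m%:R^-1.
set V := L * Delta ^+ 2 / (mu ^+ 2 * K%:R ^+ 2).
have V0 : 0 <= V.
  by apply: divr_ge0; apply: mulr_ge0 => //; exact: sqr_ge0.
set E := H * T * expR (- (204^-1 * mn * K%:R)).
have E0 : 0 <= E.
  by apply: mulr_ge0 (expR_ge0 _); apply: mulr_ge0 => //; exact: ltW.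
have lam2 : 1 <= lam ^+ 2 by rewrite exprn_ege1.
have big (a b : R) : a <= 200 * E + V -> b <= 1200 * lam ^+ 2 * V ->
    a + b <= 2000 * lam ^+ 2 * (E + V).
  move=> ha hb.
  have := ler_wpM2r E0 lam2; have := ler_wpM2r V0 lam2.
  rewrite mul1r mul1r; lra.
have WK g W : K.+1%:R * expR (ec_eta g mu m%:R^-1 * K%:R / 2) <= W ->
    0 < g -> 2 / g * T / W
      <= 2 * T * (g * K%:R)^-1 * expR (- (ec_eta g mu m%:R^-1 * K%:R / 2)).
  move=> hW g_gt0; set x := _ * _ / 2.
  have W0 : 0 < W by apply: lt_le_trans hW; rewrite mulr_gt0 ?expR_gt0.
  have : W^-1 <= (K%:R * expR x)^-1.
    rewrite lef_pV2 ?posrE ?mulr_gt0 ?expR_gt0 //; apply: le_trans hW.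
    by rewrite ler_wpM2r ?expR_ge0 // ler_nat.
  have c0 : 0 <= 2 / g * T by rewrite mulr_ge0 // divr_ge0 // ltW.
  move=> /(ler_wpM2l c0) h; apply: (le_trans h).
  rewrite expRN le_eqVlt; apply/orP; left; apply/eqP; field.
  by rewrite (gt_eqF g_gt0) (gt_eqF KK) gt_eqF // expR_gt0.
have caseg0 : Delta = 0 \/ g0 <= 12 * lam / (mu * K%:R) ->
    forall W, K.+1%:R * expR (ec_eta g0 mu m%:R^-1 * K%:R / 2) <= W ->
    2 / g0 * T / W + 8 * L * g0 ^+ 2 * Delta ^+ 2 <= 2000 * lam ^+ 2 * (E + V).
  move=> small W hW; apply: big.
    apply: (le_trans (WK _ _ hW g0_gt0)).
    apply: (@le_trans _ _ (102 * E)); last by have := V0; have := E0; lra.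
    have h1 : expR (- (ec_eta g0 mu m%:R^-1 * K%:R / 2))
        <= expR (- (204^-1 * mn * K%:R)).
      rewrite ler_expR lerN2.
      (* One branch of eta / 2 is g0 mu / 4 with g0 >= 1 / (51 H), whence 204 = 4 * 51; the other is
         1 / (8 m). *)
      suff key : 204^-1 * mn <= ec_eta g0 mu m%:R^-1 / 2.
        by have := ler_wpM2r (ltW KK) key; lra.
      rewrite /ec_eta.
      have g0_ge : (51 * H)^-1 <= g0.
        have gV_gt0 : 0 < g0^-1 by rewrite invr_gt0.
        have H51 : 0 < 51 * H by exact: mulr_gt0.
        by rewrite -(invrK g0) lef_pV2 // posrE.
      have mn1 : mn <= mu / H by rewrite ge_min lexx.
      have mn2 : mn <= m%:R^-1 by rewrite ge_min lexx orbT.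
      have mV : 0 < m%:R^-1 :> R by rewrite invr_gt0.
      have mng : 51^-1 * mn <= g0 * mu.
        apply: (@le_trans _ _ ((51 * H)^-1 * mu)); last by rewrite ler_wpM2r // ltW.
        by rewrite invfM -mulrA ler_wpM2l // mulrC.
      rewrite ler_pdivlMr // le_min; apply/andP; split; lra.
    have h2 : (g0 * K%:R)^-1 <= 51 * H.
      apply: le_trans g0V_le; rewrite lef_pV2 ?posrE ?mulr_gt0 //.
      by rewrite ler_pMr // ler1n.
    have h3 : 2 * T * (g0 * K%:R)^-1 <= 102 * (H * T).
      by have := ler_wpM2l T0 h2; lra.
    rewrite /E mulrA; apply: ler_pM h3 h1; last exact: expR_ge0.
    apply: mulr_ge0; first exact: mulr_ge0.
    by rewrite invr_ge0 ltW // mulr_gt0.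
  have lamV : 0 <= lam ^+ 2 * V by apply: mulr_ge0 => //; exact: sqr_ge0.
  case: small => [D0|small].
    have -> : 8 * L * g0 ^+ 2 * Delta ^+ 2 = 0 by rewrite D0 expr0n /= mulr0.
    lra.
  have q_gt0 : 0 < 12 * lam / (mu * K%:R) by apply: divr_gt0; exact: mulr_gt0.
  have h : g0 ^+ 2 <= (12 * lam / (mu * K%:R)) ^+ 2.
    by apply: lerXn2r small; rewrite nnegrE ltW.
  have LD : 0 <= 8 * L * Delta ^+ 2 by apply: mulr_ge0 (sqr_ge0 _); exact: mulr_ge0.
  have := ler_wpM2l LD h.
  have -> : 8 * L * Delta ^+ 2 * (12 * lam / (mu * K%:R)) ^+ 2 = 1152 * lam ^+ 2 * V.
    by rewrite /V; field; rewrite !gt_eqF.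
  by lra.
(* A zero [Delta] leaves no trace in [logs], as ln 0 = 0, but then there is no noise term and gamma0
   itself will do. *)
have [D0|D_neq0] := eqVneq Delta 0.
  by exists g0; split; [rewrite g0_gt0 lexx|apply: caseg0; left].
have [small|large] := lerP g0 (12 * lam / (mu * K%:R)).
  by exists g0; split; [rewrite g0_gt0 lexx|apply: caseg0; right].
have D_gt0 : 0 < Delta by rewrite lt_def D_neq0.
set g := 12 * lam / (mu * K%:R) in large *.
have g_gt0 : 0 < g by apply: divr_gt0; exact: mulr_gt0.
exists g; split; first by rewrite g_gt0 ltW.
move=> W hW; apply: big; last first.
  have -> : 8 * L * g ^+ 2 * Delta ^+ 2 = 1152 * lam ^+ 2 * V.
    by rewrite /g /V; field; rewrite !gt_eqF.
  have : 0 <= lam ^+ 2 * V by apply: mulr_ge0 => //; exact: sqr_ge0.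
  lra.
apply: (le_trans (WK _ _ hW g_gt0)).
have gKE : (g * K%:R)^-1 = mu / (12 * lam) by rewrite /g; field; rewrite !gt_eqF.
have gK_le : (g * K%:R)^-1 <= mu.
  rewrite gKE ler_pdivrMr ?mulr_gt0 // ler_peMr ?ltW //; lra.
rewrite /ec_eta; have [gm|gm] := lerP (g * mu / 2) (m%:R^-1 / 4).
  have -> : g * mu / 2 * K%:R / 2 = 3 * lam by rewrite /g; field; rewrite !gt_eqF.
  have [->|T_neq0] := eqVneq T 0.
    by rewrite mulr0 mul0r mul0r addr_ge0 // mulr_ge0.
  have T_gt0 : 0 < T by rewrite lt_def T_neq0.
  have := polylog_small mu_gt0 L_gt0 D_gt0 T_gt0; rewrite -/lam -/V.
  have e0 : 0 <= T * expR (- (3 * lam)) by rewrite mulr_ge0 ?expR_ge0.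
  have gK2 : (g * K%:R)^-1 <= mu / 2.
    rewrite gKE ler_wpM2l ?(ltW mu_gt0) // lef_pV2 ?posrE ?mulr_gt0 //; lra.
  have := ler_wpM2l e0 gK2; have := E0; lra.
have h1 : expR (- (m%:R^-1 / 4 * K%:R / 2)) <= expR (- (204^-1 * mn * K%:R)).
  rewrite ler_expR lerN2.
  suff key : 204^-1 * mn <= m%:R^-1 / 4 / 2.
    by have := ler_wpM2r (ltW KK) key; lra.
  have mn2 : mn <= m%:R^-1 by rewrite ge_min lexx orbT.
  have mV : 0 < m%:R^-1 :> R by rewrite invr_gt0.
  lra.
apply: (@le_trans _ _ (4 * E)); last by have := V0; have := E0; lra.
(* Here 1 / (g K) = mu / (12 logs) <= mu <= 2 L <= 2 H. *)
have h3 : 2 * T * (g * K%:R)^-1 <= 4 * (H * T).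
  have LH : L <= H by rewrite lerDl divr_ge0 // ltW.
  have gKH : (g * K%:R)^-1 <= 2 * H.
    by rewrite (le_trans gK_le) // (le_trans muL) // ler_wpM2l.
  by have := ler_wpM2l T0 gKH; lra.
rewrite /E mulrA; apply: ler_pM h3 h1; last exact: expR_ge0.
apply: mulr_ge0; first exact: mulr_ge0.
by rewrite invr_ge0 ltW // mulr_gt0.
Qed.

End stepsize_choice_strongly_convex.

Section stepsize_choice_convex.
Variables (R : realType) (n m K : nat) (L Ls Delta : R).
Hypotheses (n_gt0 : (0 < n)%N) (m_gt0 : (0 < m)%N) (K_gt0 : (0 < K)%N).
Hypotheses (L0 : 0 <= L) (Ls0 : 0 < Ls) (Delta0 : 0 <= Delta).

Let nn : 0 < n%:R :> R. Proof. by rewrite ltr0n. Qed.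
Let mm : 0 < m%:R :> R. Proof. by rewrite ltr0n. Qed.
Let KK : 0 < K%:R :> R. Proof. by rewrite ltr0n. Qed.
Let g0 := gamma0 n L Ls.
Let H := L + Ls / n%:R.

Let H_gt0 : 0 < H. Proof. by rewrite ltr_wpDl // divr_gt0. Qed.
Let g0_gt0 : 0 < g0. Proof. exact: gamma0_gt0. Qed.

Let g0V_le : g0^-1 <= 51 * H.
Proof.
rewrite invrK /H mulrDr; apply: lerD.
  by rewrite ler_wpM2r // ler_nat.
rewrite (_ : 152 * Ls / _ = 152 / 3 * (Ls / n%:R)); last by field; rewrite gt_eqF.
by rewrite ler_wpM2r ?divr_ge0 ?ltW //; lra.
Qed.

(** Besides gamma <= gamma0, two conditions matter. gamma S <= 1, with S^2 = m Ls L / n, controls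
    the reference term through gap0 <= L R0^2 / 2. gamma Q <= 1, with Q = (L Delta^2 K /
    R0^2)^(1/3), balances R0^2 / (gamma K) against L gamma^2 Delta^2: at gamma = 1 / Q both equal
    the last term X of the rate. *)
Lemma convex_stepsize (R0 : R) : 0 <= R0 -> (R0 = 0 -> Delta = 0) ->
  exists gamma : R, 0 < gamma <= g0 /\
  forall W gap0, K.+1%:R <= W -> gap0 <= L / 2 * R0 ^+ 2 ->
    2 / gamma * (R0 ^+ 2 + 16 * m%:R * Ls / (3 * n%:R) * gamma ^+ 2 * gap0) / W
      + 8 * L * gamma ^+ 2 * Delta ^+ 2
    <= 2000 * rate_convex K n m L Ls Delta R0.
Proof.
move=> R00 R0D.
(* With cube roots as variables, the fractional powers become integer powers and the identities on Q
   and X rational. *)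
have cube (x : R) : 0 <= x -> x = (x `^ (1 / 3)) ^+ 3.
  by move=> x0; rewrite -powR_mulrn ?powR_ge0 // -powRrM div1r mulVf ?powRr1.
have powk (x : R) k : 0 <= x -> x `^ (k%:R / 3) = (x `^ (1 / 3)) ^+ k.
  by move=> x0; rewrite -powR_mulrn ?powR_ge0 // -powRrM; congr (_ `^ _); field.
set l := L `^ (1 / 3); set dd := Delta `^ (1 / 3); set r := R0 `^ (1 / 3).
set kp := K%:R `^ (1 / 3) : R.
have LE : L = l ^+ 3 := cube _ L0.
have DE : Delta = dd ^+ 3 := cube _ Delta0.
have RE : R0 = r ^+ 3 := cube _ R00.
have KE : K%:R = kp ^+ 3 := cube _ (ltW KK).
have kp_gt0 : 0 < kp by rewrite powR_gt0.
pose S := Num.sqrt (m%:R * Ls * L) / Num.sqrt n%:R.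
have S0 : 0 <= S by rewrite divr_ge0 ?sqrtr_ge0.
have S2 : S ^+ 2 = m%:R * Ls * L / n%:R.
  by rewrite expr_div_n !sqr_sqrtr ?mulr_ge0 // ltW.
pose Q := l * dd ^+ 2 * kp / r ^+ 2.
have [l0 dd0 r0] : [/\ 0 <= l, 0 <= dd & 0 <= r] by rewrite !powR_ge0.
have Q0 : 0 <= Q.
  apply: divr_ge0 (sqr_ge0 _); apply: mulr_ge0 (ltW kp_gt0).
  by apply: mulr_ge0 => //; exact: sqr_ge0.
pose X := l * r ^+ 4 * dd ^+ 2 / kp ^+ 2.
have X0 : 0 <= X.
  apply: divr_ge0 (sqr_ge0 _); apply: mulr_ge0 (sqr_ge0 _).
  by apply: mulr_ge0 => //; exact: exprn_ge0.
have QX : R0 ^+ 2 * Q / K%:R = X.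
  rewrite RE KE /Q /X; have [->|rn] := eqVneq r 0; first by rewrite !expr0n /= !(mul0r, mulr0).
  by field; rewrite rn gt_eqF.
have LX : L * Delta ^+ 2 = X * Q ^+ 2.
  (* For R0 = 0 the right side is 0, so this is where Delta = 0 is required. *)
  have [rz|rn] := eqVneq r 0.
    rewrite R0D; first by rewrite /X rz !expr0n /= !(mul0r, mulr0).
    by rewrite RE rz expr0n.
  by rewrite LE DE /Q /X; field; rewrite rn gt_eqF.
have rateE : rate_convex K n m L Ls Delta R0
    = H * R0 ^+ 2 / K%:R + S * R0 ^+ 2 / K%:R + X.
  rewrite /rate_convex -/H; congr (_ + _ + _).
    by rewrite /S; field; rewrite (gt_eqF KK) gt_eqF // sqrtr_gt0.
  rewrite /X !(powk _ 4%N) ?(powk _ 2%N) //.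
(* Adding the inverses, instead of taking the minimum of the stepsizes, makes the
   cases L = 0, Delta = 0 and R0 = 0 harmless although the junk value 0^-1 = 0
   occurs in Q. *)
pose g := (g0^-1 + S + Q)^-1.
have g0V_gt0 : 0 < g0^-1 by rewrite invr_gt0.
have den_gt0 : 0 < g0^-1 + S + Q by apply: ltr_wpDr => //; exact: ltr_wpDr.
have g_gt0 : 0 < g by rewrite invr_gt0.
have gS : g * S <= 1 by rewrite mulrC ler_pdivrMr // mul1r; lra.
have gQ : g * Q <= 1 by rewrite mulrC ler_pdivrMr // mul1r; lra.
have gle : g <= g0 by rewrite -(invrK g0) lef_pV2 ?posrE //; lra.
exists g; split; first by rewrite g_gt0.
move=> W gap0 hW hgap; rewrite rateE.
have W_gt0 : 0 < W by apply: lt_le_trans hW.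
have WK : W^-1 <= K%:R^-1.
  by rewrite lef_pV2 ?posrE // (le_trans _ hW) // ler_nat.
have b3 : 8 * L * g ^+ 2 * Delta ^+ 2 <= 8 * X.
  rewrite (_ : 8 * L * _ * _ = 8 * (L * Delta ^+ 2) * g ^+ 2); last by ring.
  rewrite LX (_ : 8 * (X * _) * _ = 8 * X * (g * Q) ^+ 2); last by ring.
  have gQ0 : 0 <= g * Q by rewrite mulr_ge0 // ltW.
  have : 8 * X * (g * Q) ^+ 2 <= 8 * X * 1.
    by apply: ler_wpM2l; [exact: mulr_ge0|exact: exprn_ile1].
  by rewrite mulr1.
have num_le : 2 / g * (R0 ^+ 2 + 16 * m%:R * Ls / (3 * n%:R) * g ^+ 2 * gap0)
    <= 2 * R0 ^+ 2 * (51 * H + S + Q) + 16 / 3 * S * R0 ^+ 2.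
  rewrite mulrDr; apply: lerD.
    rewrite (_ : 2 / g * _ = 2 * R0 ^+ 2 * g^-1); last by rewrite mulrAC.
    by rewrite ler_wpM2l ?mulr_ge0 ?sqr_ge0 // invrK !lerD2r.
  have c0 : 0 <= 32 * m%:R * Ls / (3 * n%:R) * g.
    by rewrite !mulr_ge0 ?invr_ge0 ?mulr_ge0 // ltW.
  rewrite (_ : 2 / g * _ = 32 * m%:R * Ls / (3 * n%:R) * g * gap0); last first.
    by field; rewrite !gt_eqF.
  apply: (le_trans (ler_wpM2l c0 hgap)).
  rewrite (_ : _ * g * _ = 16 / 3 * (g * S) * S * R0 ^+ 2); last first.
    rewrite -[X in _ = X](_ : 16 / 3 * g * S ^+ 2 * R0 ^+ 2 = _); last by ring.
    by rewrite S2; field; rewrite gt_eqF.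
  rewrite ler_wpM2r ?sqr_ge0 // ler_wpM2r // ler_piMr //.
have num0 : 0 <= 2 * R0 ^+ 2 * (51 * H + S + Q) + 16 / 3 * S * R0 ^+ 2.
  have h1 : 0 <= R0 ^+ 2 * (51 * H + S + Q).
    by apply: mulr_ge0 (sqr_ge0 _) _; have := H_gt0; lra.
  have h2 : 0 <= S * R0 ^+ 2 by apply: mulr_ge0 => //; exact: sqr_ge0.
  lra.
have WV_ge0 : 0 <= W^-1 by rewrite invr_ge0 ltW.
have h := ler_wpM2r WV_ge0 num_le.
have h2 := ler_wpM2l num0 WK.
apply: (le_trans (lerD (le_trans h h2) b3)).
have -> : (2 * R0 ^+ 2 * (51 * H + S + Q) + 16 / 3 * S * R0 ^+ 2) / K%:R
  = 102 * (H * R0 ^+ 2 / K%:R) + (2 + 16 / 3) * (S * R0 ^+ 2 / K%:R)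
    + 2 * (R0 ^+ 2 * Q / K%:R) by field; rewrite gt_eqF.
rewrite QX.
have : 0 <= H * R0 ^+ 2 / K%:R.
  by apply: divr_ge0 (ltW KK); apply: mulr_ge0 (ltW H_gt0) (sqr_ge0 _).
have : 0 <= S * R0 ^+ 2 / K%:R.
  by apply: divr_ge0 (ltW KK); apply: mulr_ge0 S0 (sqr_ge0 _).
lra.
Qed.

End stepsize_choice_convex.

(** * The bound for a fixed stepsize *)

Lemma convex_function_le (R : realType) (d : nat) (f : 'rV[R]_d -> R)
    (t : R) (x y : 'rV[R]_d) :
  convex_function [set: 'rV[R]_d] f -> 0 <= t -> t <= 1 ->
  f (t *: x + (1 - t) *: y) <= t * f x + (1 - t) * f y.
Proof.
move=> cf t0 t1; have := cf (Itv01 t0 t1) x y.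
by rewrite !inE => /(_ I I).
Qed.

(** Jensen's inequality by induction: the last point is split off, and the earlier average receives
    the weight t = S / (S + w). *)
Lemma convex_weighted_average_le (R : realType) (d : nat) (f : 'rV[R]_d -> R)
    (wt : nat -> R) (x : nat -> 'rV[R]_d) (K : nat) :
  convex_function [set: 'rV[R]_d] f -> (forall k, 0 < wt k) ->
  f ((\sum_(k < K.+1) wt k)^-1 *: \sum_(k < K.+1) wt k *: x k)
    <= (\sum_(k < K.+1) wt k)^-1 * \sum_(k < K.+1) wt k * f (x k).
Proof.
move=> cf wt0.
have S_gt0 k : 0 < \sum_(j < k.+1) wt j.
  by rewrite big_ord_recr /= ltr_wpDl // sumr_ge0 // => j _; exact: ltW.
elim: K => [|K IHK].
  rewrite !big_ord1 scalerA mulrA mulVf ?mul1r ?scale1r //.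
  by rewrite gt_eqF.
have := S_gt0 K.+1.
rewrite !(big_ord_recr K.+1) /=.
have := S_gt0 K; move: IHK.
move: (\sum_(k < K.+1) wt k) (\sum_(k < K.+1) wt k *: x k) (\sum_(k < K.+1) wt k * f (x k)).
move: (wt K.+1) (wt0 K.+1) (x K.+1) => w w0 y S X F IHK S0 Sw.
pose t := S / (S + w).
have t0 : 0 <= t by rewrite divr_ge0 ?ltW.
have t1 : t <= 1 by rewrite ler_pdivrMr // mul1r lerDl ltW.
have := convex_function_le (S^-1 *: X) y cf t0 t1.
have -> : t *: (S^-1 *: X) + (1 - t) *: y = (S + w)^-1 *: (X + w *: y).
  rewrite scalerDr !scalerA; congr (_ *: _ + _ *: _); rewrite /t; field.
    by rewrite (gt_eqF S0) gt_eqF.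
  by rewrite gt_eqF.
move=> /le_trans; apply.
have := ler_wpM2l t0 IHK => h.
apply: (le_trans (lerD h (lexx _))).
rewrite le_eqVlt; apply/orP; left; apply/eqP; rewrite /t; field.
by rewrite (gt_eqF S0) gt_eqF.
Qed.

Section expected_gap.
Variables (R : realType) (d n m : nat).
Variable fij : 'I_n -> 'I_m -> 'rV[R]_d -> R.
Variable D : 'I_n -> probability (borel_rV R m) R.
Variables (mu L Ls Delta : R) (xstar x0 : 'rV[R]_d).
Hypotheses (n_gt0 : (0 < n)%N) (m_gt0 : (0 < m)%N).
Hypotheses (mu0 : 0 <= mu) (L0 : 0 <= L) (Ls0 : 0 < Ls).
Hypothesis dfij : forall i j x, differentiable (fij i j) x.
Hypothesis cf : convex_function [set: 'rV[R]_d] (fobj fij).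
Hypothesis fmin : forall x, fobj fij xstar <= fobj fij x.
Hypothesis qsc : quasi_strongly_convex (fobj fij) xstar mu.
Hypothesis smf : smooth (fobj fij) L.
Hypothesis mean1 : unit_mean_sampling D.
Hypothesis ES : expected_smoothness fij D xstar Ls.
Variables (dZ : measure_display) (Z : measurableType dZ) (Q : probability Z R).
Variable C : Z -> 'rV[R]_d -> 'rV[R]_d.
Hypothesis CQ : absolute_compressor Q C Delta.
Variables (dO : measure_display) (Omega : measurableType dO).
Variable P : probability Omega R.
Variable xi : nat -> 'I_n -> {RV P >-> borel_rV R m}.
Variable zeta : nat -> 'I_n -> {RV P >-> Z}.
Variable coin : nat -> {RV P >-> bool}.
Hypothesis noise : ec_lsvrg_noise D Q (m%:R^-1) xi zeta coin.
Variable gamma : R.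
Hypotheses (gamma_gt0 : 0 < gamma) (gamma_le : gamma <= gamma0 n L Ls).
Hypothesis gamma_mu : gamma * mu / 2 <= 1.

Notation f := (fobj fij).
Notation gap x := (f x - f xstar).
Notation x_ k w := (ec_x (run fij C gamma x0 xi zeta coin k w)).
Notation w_ k w := (ec_w (run fij C gamma x0 xi zeta coin k w)).
Notation e_ k w := (ec_e (run fij C gamma x0 xi zeta coin k w)).
Notation u_ k w := (run_virtual fij C gamma x0 xi zeta coin xstar k w).

Let eta := ec_eta gamma mu m%:R^-1.
Let wt k : R := ((1 - eta) ^+ k.+1)^-1.
Let c := gamma * (1 - gamma * (2 * L + 4 * Ls / n%:R)).
Let Ae k := (\int[P]_w (dotv (u_ k w) (u_ k w))%:E)%E.
Let de k := (\int[P]_w (gap (x_ k w))%:E)%E.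
Let se k := (\int[P]_w (gap (w_ k w))%:E)%E.

Let gapE0 x : 0 <= gap x. Proof. by rewrite subr_ge0. Qed.
Let nn : 0 < n%:R :> R. Proof. by rewrite ltr0n. Qed.

Let gL : gamma * (2 * L + 4 * Ls / n%:R) <= 1 / 2.
Proof.
have := stepsize_le1 n_gt0 L0 Ls0 gamma_le.
have -> : 4 * Ls / n%:R = 12 * (Ls / (3 * n%:R)) by field; rewrite gt_eqF.
have : 0 <= gamma * (Ls / (3 * n%:R)).
  by rewrite mulr_ge0 ?divr_ge0 ?mulr_ge0 // ltW.
rewrite -!mulrA; lra.
Qed.

Let c_gt0 : 0 < c.
Proof. by apply: mulr_gt0 => //; have := gL; lra. Qed.

Let Ae0 k : (0 <= Ae k)%E.
Proof. by apply: integral_ge0 => w _; rewrite lee_fin dotv_ge0. Qed.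
Let de0 k : (0 <= de k)%E.
Proof. by apply: integral_ge0 => w _; rewrite lee_fin. Qed.
Let se0 k : (0 <= se k)%E.
Proof. by apply: integral_ge0 => w _; rewrite lee_fin. Qed.

Let distance_step k : (Ae k.+1 + c%:E * de k <= (1 - gamma * mu / 2)%:E * Ae k
  + (4 * L * gamma * (gamma ^+ 2 * Delta ^+ 2))%:E
  + (gamma ^+ 2 * (4 * Ls / n%:R))%:E * se k)%E.
Proof.
have gL1 : gamma * (2 * L + 4 * Ls / n%:R) <= 1 by have := gL; lra.
apply: (le_trans (run_distance_step x0 n_gt0 mu0 L0 Ls0 dfij fmin qsc smf mean1 ES
  CQ noise gamma_gt0 k gamma_mu gL1)).
rewrite leeD2r // leeD2l // [leRHS]EFinM lee_wpmul2l //.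
  by rewrite lee_fin mulr_ge0 ?mulr_ge0 // ltW.
exact: (run_mean_error_sqr_le x0 n_gt0 dfij CQ noise gamma_gt0 k).
Qed.

Let reference_step k :
  (se k.+1 <= (m%:R^-1)%:E * de k + (1 - m%:R^-1)%:E * se k)%E.
Proof. exact: (run_reference_step x0 m_gt0 dfij fmin CQ noise gamma k). Qed.

Let Ae_0 : Ae 0 = (enorm (x0 - xstar) ^+ 2)%:E.
Proof.
rewrite /Ae; under eq_integral do rewrite /run_virtual /= big1 // scaler0 subr0.
by rewrite integral_cst // [X in (_ * X)%E](probability_setT P) mule1 sqr_enorm.
Qed.

Let se_0 : se 0 = (gap x0)%:E.
Proof.
rewrite /se /=; under eq_integral do rewrite /=.
by rewrite integral_cst // [X in (_ * X)%E](probability_setT P) mule1.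
Qed.

(** The distance recursion bounds Ae k.+1 and c de k together. As c > 0, the gap at x_k has finite
    mean, and then so has the next reference gap. *)
Let fin_step k : (Ae k < +oo -> se k < +oo ->
  [/\ Ae k.+1 < +oo, de k < +oo & se k.+1 < +oo])%E.
Proof.
move=> Ak sk.
have Af : Ae k \is a fin_num by rewrite ge0_fin_numE.
have sf : se k \is a fin_num by rewrite ge0_fin_numE.
have rhs : (Ae k.+1 + c%:E * de k < +oo)%E.
  apply: (le_lt_trans (distance_step k)).
  by rewrite -(fineK Af) -(fineK sf) -!EFinM -!EFinD ltry.
have cd0 : (0 <= c%:E * de k)%E by rewrite mule_ge0 // lee_fin ltW.
have A1 : (Ae k.+1 < +oo)%E by apply: le_lt_trans rhs; rewrite leeDl.
have d1 : (de k < +oo)%E.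
  rewrite ltNge leye_eq; apply/eqP => dy; move: rhs.
  by rewrite dy gt0_muley ?lte_fin // addey // gt_eqF // (lt_le_trans _ (Ae0 _)) // ltNyr.
have df : de k \is a fin_num by rewrite ge0_fin_numE.
split=> //; apply: (le_lt_trans (reference_step k)).
by rewrite -(fineK df) -(fineK sf) -!EFinM -!EFinD ltry.
Qed.

Let fin_all k : (Ae k < +oo /\ se k < +oo)%E.
Proof.
elim: k => [|k [Ak sk]]; first by rewrite Ae_0 se_0 !ltry.
by have [] := fin_step Ak sk.
Qed.

Let AeE k : Ae k = (fine (Ae k))%:E.
Proof. by have [Ak _] := fin_all k; rewrite fineK // ge0_fin_numE. Qed.
Let seE k : se k = (fine (se k))%:E.
Proof. by have [_ sk] := fin_all k; rewrite fineK // ge0_fin_numE. Qed.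
Let deE k : de k = (fine (de k))%:E.
Proof.
have [Ak sk] := fin_all k; have [_ dk _] := fin_step Ak sk.
by rewrite fineK // ge0_fin_numE.
Qed.

Lemma expected_gap_le K :
  ('E_P[fun w => (f (weighted_average eta (fun k => x_ k w) K) - f xstar)%R]
   <= (2 / gamma * (enorm (x0 - xstar) ^+ 2
        + 16 * m%:R * Ls / (3 * n%:R) * gamma ^+ 2 * gap x0)
          / \sum_(k < K.+1) wt k
       + 8 * L * gamma ^+ 2 * Delta ^+ 2)%:E)%E.
Proof.
set W := \sum_(k < K.+1) wt k.
have eta_lt1 : 0 < 1 - eta.
  have := ec_eta_le mu gamma m_gt0; rewrite -/eta; lra.
have wt_gt0 k : 0 < wt k by rewrite invr_gt0 exprn_gt0.
have W_gt0 : 0 < W.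
  by rewrite /W big_ord_recr /= ltr_wpDl // sumr_ge0 // => j _; exact: ltW.
have mx k : measurable_fun setT ((fun w => x_ k w) : Omega -> borel_rV R d).
  by case: (@measurable_run _ _ _ _ fij dfij _ _ C (proj1 CQ) gamma x0 _ Omega
    (fun k i => xi k i) (fun k i => zeta k i) (fun k => coin k) k
    (fun _ _ _ => measurable_funPT _) (fun _ _ _ => measurable_funPT _)
    (fun _ _ => measurable_funPT _)).
have mf : measurable_fun setT ((fun x => gap x) : borel_rV R d -> R).
  apply: measurable_funB => //; apply: continuous_measurable_borel => x.
  by apply: differentiable_continuous; exact: differentiable_fobj.
have mgx k : measurable_fun setT (fun w => gap (x_ k w)) by exact: (measurableT_comp mf).
have jensen w : gap (weighted_average eta (fun k => x_ k w) K)
    <= W^-1 * \sum_(k < K.+1) wt k * gap (x_ k w).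
  have h := convex_weighted_average_le (fun k => x_ k w) K cf wt_gt0.
  have -> : W^-1 * \sum_(k < K.+1) wt k * gap (x_ k w)
      = W^-1 * \sum_(k < K.+1) wt k * f (x_ k w) - f xstar.
    under eq_bigr do rewrite mulrBr.
    by rewrite sumrB -mulr_suml mulrBr mulKf // gt_eqF.
  by rewrite lerD2r.
rewrite unlock.
apply: (@le_trans _ _ (\int[P]_w (W^-1%:E * \sum_(k < K.+1) (wt k * gap (x_ k w))%:E))%E).
  apply: ge0_le_integral => //.
  - by move=> w _; rewrite lee_fin.
  - apply/measurable_EFinP; apply: (measurableT_comp mf).
    apply: measurable_rowZ => //; apply: measurable_row_sum => k.
    by apply: measurable_rowZ.
  - apply: emeasurable_funM => //; apply: emeasurable_sum => k.
    by apply/measurable_EFinP; exact: measurable_funM.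
  - by move=> w _; rewrite sumEFin -EFinM lee_fin.
have wg0 k w : 0 <= wt k * gap (x_ k w) by rewrite mulr_ge0 // ltW.
have mwg k : measurable_fun setT (fun w => (wt k * gap (x_ k w))%:E).
  by apply/measurable_EFinP; exact: measurable_funM.
have ms : measurable_fun setT
    (fun w => \sum_(k < K.+1) (wt k * gap (x_ k w))%:E)%E by exact: emeasurable_sum.
have s0 w : setT w -> (0 <= \sum_(k < K.+1) (wt k * gap (x_ k w))%:E)%E.
  by move=> _; rewrite sumEFin lee_fin sumr_ge0.
rewrite (ge0_integralZl_EFin P measurableT s0 ms) ?invr_ge0 ?(ltW W_gt0) //.
rewrite ge0_integral_sum //; last by move=> k w _; rewrite lee_fin.
have intE k : (\int[P]_w (wt k * gap (x_ k w))%:E = (wt k * fine (de k))%:E)%E.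
  under eq_integral do rewrite EFinM.
  have mE : measurable_fun setT (fun w => (gap (x_ k w))%:E) by exact/measurable_EFinP.
  have gE w : setT w -> (0 <= (gap (x_ k w))%:E)%E by rewrite lee_fin.
  by rewrite (ge0_integralZl_EFin P measurableT gE mE) ?(ltW (wt_gt0 _)) // -/(de k) deE.
under eq_bigr do rewrite intE.
rewrite sumEFin -EFinM lee_fin.
have key := @weighted_recursion_le R n m mu L Ls Delta gamma n_gt0 m_gt0 L0
  Ls0 gamma_gt0 gamma_le (fine \o Ae) (fine \o de) (fine \o se).
(* The average includes x_K, hence K.+1 terms. *)
have {key} := key _ _ _ _ _ K.+1 => /=; rewrite -/eta -/W.
rewrite Ae_0 se_0 /= => key.
rewrite mulrC ler_pdivrMr // mulrDl divfK ?gt_eqF //; apply: key.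
- by move=> k; rewrite fine_ge0.
- by move=> k; rewrite fine_ge0.
- by move=> k; rewrite fine_ge0.
- move=> k; rewrite -lee_fin !(EFinD, EFinM); have := distance_step k.
  by rewrite AeE (AeE k) deE seE.
- move=> k; have := reference_step k.
  by rewrite seE (seE k) deE -!EFinM -EFinD lee_fin.
Qed.

End expected_gap.

(** * Assembly of the convergence theorem *)

Section rates_ge0.
Variables (R : realType) (K n m : nat) (L Ls : R).
Hypotheses (L0 : 0 <= L) (Ls0 : 0 <= Ls).

Lemma rate_strongly_convex_ge0 (a mu Delta T : R) : 0 <= T ->
  0 <= rate_strongly_convex a K n m mu L Ls Delta T.
Proof.
move=> T0; apply: addr_ge0.
  apply: mulr_ge0 (expR_ge0 _); apply: mulr_ge0 => //.
  by apply: addr_ge0 => //; exact: divr_ge0.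
by apply: divr_ge0; apply: mulr_ge0; rewrite ?sqr_ge0.
Qed.

Lemma rate_convex_ge0 (Delta R0 : R) : 0 <= rate_convex K n m L Ls Delta R0.
Proof.
apply: addr_ge0; last first.
  by apply: divr_ge0 (powR_ge0 _ _); rewrite !mulr_ge0 ?powR_ge0.
apply: addr_ge0.
  apply: divr_ge0 (ler0n _ _); apply: mulr_ge0 (sqr_ge0 _).
  by apply: addr_ge0 => //; exact: divr_ge0.
apply: divr_ge0; first by apply: mulr_ge0 (sqr_ge0 _); exact: sqrtr_ge0.
by apply: mulr_ge0 (ler0n _ _); exact: sqrtr_ge0.
Qed.

End rates_ge0.

(** If mu = 0 and x0 = xstar, the convex rate is 0, while the compression error under a positive
    stepsize can still move the iterates away from xstar; the hypothesis on Delta excludes this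
    case. *)
Theorem theorem4p2 (R : realType) :
  exists (A a : R) (q : nat), 0 < A /\ 0 < a /\
  forall (d n m : nat) (fij : 'I_n -> 'I_m -> 'rV[R]_d -> R)
    (D : 'I_n -> probability (borel_rV R m) R)
    (mu L Ls Delta : R) (xstar x0 : 'rV[R]_d) (K : nat),
  let f := fobj fij in
  let R0 := enorm (x0 - xstar) in
  let g0 := gamma0 n L Ls in
  let T := Ttilde0 n m L Ls R0 (f x0 - f xstar) in
  let p := m%:R^-1 : R in
  (0 < n)%N -> (0 < m)%N -> (0 < K)%N ->
  0 <= mu -> 0 <= L -> 0 < Ls -> 0 <= Delta ->
  (forall i j x, differentiable (fij i j) x) ->
  convex_function [set: 'rV[R]_d] f ->
  unique_minimizer f xstar ->
  quasi_strongly_convex f xstar mu ->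
  smooth f L ->
  unit_mean_sampling D ->
  expected_smoothness fij D xstar Ls ->
  (mu = 0 -> x0 = xstar -> Delta = 0) ->
  exists gamma : R, 0 < gamma <= g0 /\
  forall (dZ : measure_display) (Z : measurableType dZ) (Q : probability Z R)
    (C : Z -> 'rV[R]_d -> 'rV[R]_d),
  absolute_compressor Q C Delta ->
  forall (dO : measure_display) (Omega : measurableType dO)
    (P : probability Omega R)
    (xi : nat -> 'I_n -> {RV P >-> borel_rV R m})
    (zeta : nat -> 'I_n -> {RV P >-> Z})
    (coin : nat -> {RV P >-> bool}),
  ec_lsvrg_noise D Q p xi zeta coin ->
  let x k omega := ec_x (ec_lsvrg fij gamma (fun k i => xi k i omega)
    (fun k i => C (zeta k i omega)) (fun k => coin k omega) x0 k) in
  let xbar omega := weighted_average (ec_eta gamma mu p) (x ^~ omega) K in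
  (0 < mu ->
     ('E_P[fun omega => (f (xbar omega) - f xstar)%R]
      <= (A * logs K n m mu L Ls Delta T ^+ q
            * rate_strongly_convex a K n m mu L Ls Delta T)%:E)%E) /\
  (mu = 0 ->
     ('E_P[fun omega => (f (xbar omega) - f xstar)%R]
      <= (A * rate_convex K n m L Ls Delta R0)%:E)%E).
Proof.
(* The exponent 2 of [logs] comes from the square of the stepsize in the noise term; 2000 serves
   both regimes. *)
exists 2000, 204^-1, 2%N; split; first by rewrite ltr0n.
split; first by rewrite invr_gt0 ltr0n.
move=> d n m fij D mu L Ls Delta xstar x0 K f R0 g0 T p n_gt0 m_gt0 K_gt0.
move=> mu0 L0 Ls0 Delta0 dfij cf [fmin funiq] qsc smf mean1 ES degenerate.
have df := differentiable_fobj dfij.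
have nn : 0 < n%:R :> R by rewrite ltr0n.
have mm : 0 < m%:R :> R by rewrite ltr0n.
have g0_gt0 : 0 < g0 by exact: gamma0_gt0.
have gap0_ge0 : 0 <= f x0 - f xstar by rewrite subr_ge0.
have R0_ge0 : 0 <= R0 by exact: enorm_ge0.
have c0 : 0 <= m%:R / (3 * n%:R) * Ls * (f x0 - f xstar).
  apply: mulr_ge0 gap0_ge0; apply: mulr_ge0 (ltW Ls0).
  by apply: divr_ge0 (ltW mm) _; exact: mulr_ge0 (ltW nn).
have c1 := mulr_ge0 c0 (sqr_ge0 g0).
have T_ge0 : 0 <= T.
  by rewrite /T /Ttilde0 -/g0; have := sqr_ge0 R0; lra.
(* The Lyapunov function starts with the constant 16 / 3, below the 64 / 3 of [Ttilde0], and gamma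
   <= gamma0. *)
have T_ge gamma : 0 < gamma <= g0 -> R0 ^+ 2
    + 16 * m%:R * Ls / (3 * n%:R) * gamma ^+ 2 * (f x0 - f xstar) <= T.
  move=> /andP[gamma_gt0 gamma_le]; rewrite lerD2l.
  have gg : gamma ^+ 2 <= g0 ^+ 2 by apply: lerXn2r gamma_le; rewrite nnegrE ltW.
  by have := ler_wpM2l c0 gg; rewrite -/g0; lra.
(* In dimension 0 there is no unit vector, so mu is not bounded by 2 L; but the space is a single
   point and the gap is 0. *)
have [d0|d_gt0] := posnP d.
  subst d; exists g0; split; first by rewrite g0_gt0 lexx.
  move=> dZ Z Q C _ dO Omega P xi zeta coin _ x xbar.
  have gap00 : ('E_P[fun omega => (f (xbar omega) - f xstar)%R] = 0)%E.
    rewrite unlock; apply: integral0_eq => w _.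
    by rewrite (thinmx0 (xbar w)) (thinmx0 xstar) subrr.
  rewrite gap00 !lee_fin; split=> _; apply: mulr_ge0.
  - by apply: mulr_ge0; rewrite ?ler0n // exprn_ge0 // (le_trans ler01) // logs_ge1.
  - by apply: rate_strongly_convex_ge0 => //; exact: ltW.
  - by rewrite ler0n.
  - by apply: rate_convex_ge0 => //; exact: ltW.
have muL : mu <= 2 * L.
  have := quasi_strongly_convex_le (delta_mx 0 (Ordinal d_gt0)) L0 df smf fmin qsc.
  have -> : dotv (delta_mx 0 (Ordinal d_gt0)) (delta_mx 0 (Ordinal d_gt0)) = 1 :> R.
    rewrite /dotv (bigD1 (Ordinal d_gt0)) //= big1 ?addr0 ?mxE ?eqxx ?mulr1 //.
    by move=> j /negPf ji; rewrite !mxE ji andbF mul0r.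
  by rewrite !mulr1.
have gamma_mu gamma : 0 < gamma <= g0 -> gamma * mu / 2 <= 1.
  move=> /andP[gamma_gt0 gamma_le].
  have := stepsize_le1 n_gt0 L0 Ls0 gamma_le.
  have := ler_wpM2l (ltW gamma_gt0) muL.
  have : 0 <= gamma * (Ls / (3 * n%:R)).
    apply: mulr_ge0 (ltW gamma_gt0) _; apply: divr_ge0 (ltW Ls0) _.
    exact: mulr_ge0 (ltW nn).
  have : 0 <= gamma * L by rewrite mulr_ge0 // ltW.
  rewrite -!mulrA; lra.
have gap0_le : f x0 - f xstar <= L / 2 * R0 ^+ 2.
  have := smooth_descent xstar (x0 - xstar) df smf.
  rewrite (grad_fobj_min L0 dfij fmin smf) dotv0l addr0 sqr_enorm.
  by rewrite [xstar + _]addrC subrK -/f; lra.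
have [mu_gt0|mu_le0] := ltrP 0 mu.
  have [gamma [gg rate]] :=
    strongly_convex_stepsize n_gt0 m_gt0 K_gt0 L0 Ls0 Delta0 mu_gt0 muL T_ge0.
  exists gamma; split=> // dZ Z Q C CQ dO Omega P xi zeta coin noise x xbar.
  have [gamma_gt0 gamma_le] := andP gg.
  split=> [_|mu00]; last by rewrite mu00 ltxx in mu_gt0.
  have := expected_gap_le x0 n_gt0 m_gt0 mu0 L0 Ls0 dfij cf fmin qsc smf mean1 ES
    CQ noise gamma_gt0 gamma_le (gamma_mu _ gg) K.
  move=> /le_trans; apply; rewrite lee_fin.
  have W := sum_weights_ge m_gt0 mu0 gamma_gt0 K.
  apply: le_trans (rate _ W); rewrite lerD2r ler_wpM2r //.
    rewrite invr_ge0; apply: le_trans W.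
    by rewrite mulr_ge0 ?expR_ge0 // ler0n.
  by rewrite ler_wpM2l ?divr_ge0 ?(ltW gamma_gt0) //; exact: T_ge.
have mu00 : mu = 0 by apply/eqP; rewrite eq_le mu_le0.
have R0D : R0 = 0 -> Delta = 0.
  move=> R00; apply: degenerate => //; apply/eqP; rewrite -subr_eq0; apply/eqP.
  by apply: dotv_eq0; rewrite -sqr_enorm -/R0 R00 expr0n.
have [gamma [gg rate]] := convex_stepsize m n_gt0 K_gt0 L0 Ls0 Delta0 R0_ge0 R0D.
exists gamma; split=> // dZ Z Q C CQ dO Omega P xi zeta coin noise x xbar.
have [gamma_gt0 gamma_le] := andP gg.
split=> [//|_].
have := expected_gap_le x0 n_gt0 m_gt0 mu0 L0 Ls0 dfij cf fmin qsc smf mean1 ES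
  CQ noise gamma_gt0 gamma_le (gamma_mu _ gg) K.
move=> /le_trans; apply; rewrite lee_fin; apply: rate gap0_le.
(* eta >= 0 makes the exponential at least 1, which leaves W >= K + 1. *)
have := sum_weights_ge m_gt0 mu0 gamma_gt0 K; apply: le_trans.
rewrite ler_peMr ?ler0n //; apply: le_trans (expR_ge1Dx _); rewrite lerDl.
apply: divr_ge0 (ler0n _ 2); apply: mulr_ge0 (ler0n _ _).
exact: (ec_eta_ge0 m_gt0 mu0 gamma_gt0).
Qed.
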